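(* Let $N\ge 2$, let $1<p<2$ and let $p'=\frac{p}{p-1}$. For $c>0$ set $$u(x)=c-\frac{|x_1|^{p'}}{p'},\qquad x\in\mathbb{R}^N .$$ Then $u\in C^1(\mathbb{R}^N)$, $-\Delta_p u=1$ in $\mathbb{R}^N$, and $u>0$ on any ball $B$ on which $|x_1|^{p'}<p'c$; thus $u$ is a positive weak solution of $-\Delta_p u=f(u)$ on $B$ with $f\equiv1$, which satisfies $(F)$. Moreover $|Du(x)|=|x_1|^{\frac{1}{p-1}}$, $Z_u=\{x_1=0\}$ and: (i) $\int_B|Du|^{-\sigma}dx<\infty$ if and only if $\sigma<p-1$; hence the summability exponent in the estimate (S) recalled in the context is optimal; (ii) $\rho=|Du|^{p-2}\in L^1(B)$ if and only if $p>\frac32$. In particular, for $1<p\le\frac32$ the weight $\rho$ need not be locally integrable, and the weighted space $H^{1,2}_\rho$ is not defined; (iii) if $p>\frac32$, then $\int_{B_r(x_0)}\rho\,dx\simeq r^{N-\theta}$ for $x_0\in Z_u$, where $\theta:=\frac{2-p}{p-1}\in(0,1)$; hence $\rho$ satisfies $(\mathcal M_\kappa)$ with $\kappa=2-\theta>1$. If $p\le\frac32$ that integral is $+\infty$ for every $r>0$.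
   Context: $\Delta_p u=\operatorname{div}(|Du|^{p-2}Du)$, and equations are understood in the weak sense: $-\Delta_pu=g$ means $\int |Du|^{p-2}(Du,D\varphi)\,dx=\int g\varphi\,dx$ for all $\varphi\in C_c^\infty$. $Z_u$ is the critical set $\{Du=0\}$ of $u$. $B_r(x_0)$ is the open ball of radius $r$ centred at $x_0$; $a(r)\simeq b(r)$ means that the two quantities are comparable up to positive multiplicative constants. Condition $(F)$: $f:[0,\infty)\to\mathbb{R}$ is continuous, positive on $(0,\infty)$ and locally Lipschitz continuous in $(0,\infty)$. Estimate (S) (Damascelli–Sciunzi), for positive weak solutions $u$ of $-\Delta_pu=f(u)$ in a domain $\Omega$ with $f$ satisfying $(F)$: $\int_{\Omega'}\frac{1}{|Du|^{(p-1)t}}\frac{1}{|x-y|^{\gamma}}\,dy\le C$ uniformly in $x$, for every $t<1$, every $\gamma<N-2$ (and $\gamma=0$ if $N=2$), and every $\Omega'$ with compact closure contained in $\Omega$. Weighted space: for a weight $0<\rho\in L^1(\Omega')$, $H^{1,2}_\rho(\Omega')$ is the space of functions $v$ with distributional gradient for which $\|v\|_{L^2(\Omega')}+\big(\int_{\Omega'}\rho|Dv|^2dx\big)^{1/2}<\infty$. Condition $(\mathcal M_\kappa)$: let $\Omega'\subset\mathbb{R}^N$ be a bounded domain and $\lambda_0,\Lambda_0,\kappa>0$. A measurable weight $\rho:\Omega'\to(0,\infty]$ satisfies $(\mathcal M_\kappa)$ in $\Omega'$ if $\rho\ge\lambda_0$ a.e. in $\Omega'$ and $\mu(B_r(x))\le\Lambda_0\,r^{N-2+\kappa}$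 for all $x\in\mathbb{R}^N$ and all $r>0$, where $\mu$ is the measure $\rho\,\chi_{\Omega'}\,dx$.
   Formalization: In (i) and (ii) the ball B is additionally required to meet the critical set Z_u={x_1=0}; for a ball whose closure misses Z_u all these integrals are finite and the ''only if'' parts fail. *)

(* Defs.v *)
(* MathComp-Analysis, over an arbitrary R : realType. *)
Set Warnings "-all".
From HB Require Import structures.
From mathcomp Require Import all_boot all_order all_algebra.
From mathcomp Require Import all_classical all_reals all_analysis measurable_realfun.

Set Implicit Arguments.
Unset Strict Implicit.
Unset Printing Implicit Defensive.
Import Order.TTheory GRing.Theory Num.Theory.
Import numFieldNormedType.Exports.

Local Open Scope classical_set_scope.
Local Open Scope ring_scope.

Section borel_rV.
Context {R : realType} {n : nat}.

Definition measurable_rV : set (set 'rV[R]_n) :=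
  g_sigma_preimage
    (fun (i : 'I_n) (x : 'rV[R]_n) => (x ord0 i : measurableTypeR R)).

Let measurable_rV0 : measurable_rV set0.
Proof. exact: sigma_algebra0. Qed.

Let measurable_rVC A : measurable_rV A -> measurable_rV (~` A).
Proof. exact: sigma_algebraC. Qed.

Let measurable_rV_bigcup (F : (set 'rV[R]_n)^nat) :
  (forall i, measurable_rV (F i)) -> measurable_rV (\bigcup_i (F i)).
Proof. exact: sigma_algebra_bigcup. Qed.

(* The Borel sigma-algebra of R^n, as the product of those of the axes. *)
HB.instance Definition _ := @isMeasurable.Build default_measure_display
  'rV[R]_n measurable_rV measurable_rV0 measurable_rVC measurable_rV_bigcup.

Lemma measurable_coord (i : 'I_n) :
  measurable_fun [set: 'rV[R]_n] (fun x => x ord0 i : measurableTypeR R).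
Proof.
move=> _ Y mY; rewrite setTI; apply: sub_sigma_algebra => /=.
rewrite -bigcup_seq/=; exists i => /=; first by rewrite mem_index_enum.
by exists Y => //; rewrite setTI.
Qed.

Lemma measurable_rVP d (T : measurableType d) (f : T -> 'rV[R]_n) :
  measurable_fun [set: T] f <->
  forall i, measurable_fun [set: T] (fun t => f t ord0 i : measurableTypeR R).
Proof.
split=> [mf i|mf].
  exact: (measurableT_comp (measurable_coord i) mf).
move=> _ A mA; rewrite setTI.
suff : preimage_set_system [set: T] f measurable_rV `<=` measurable.
  by apply; exists A => //; rewrite setTI.
rewrite /measurable_rV -g_sigma_preimage_comp.
apply: smallest_sub; first exact: sigma_algebra_measurable.
rewrite -bigcup_seq; apply: bigcup_sub => i _ _ [B mB <-].
exact: mf.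
Qed.

End borel_rV.

(* N-dimensional Lebesgue measure: iterated product of the one-dimensional one,
   transported along R * R^n = R^n.+1; lebesgue_rV_box gives its value on boxes. *)
Section lebesgue_rV.
Context {R : realType}.

Definition consrV n (z : measurableTypeR R * 'rV[R]_n) : 'rV[R]_n.+1 :=
  \row_i (if unlift ord0 i is Some j then z.2 ord0 j else z.1).

Lemma measurable_consrV n : measurable_fun setT (@consrV n).
Proof.
apply/measurable_rVP => i.
case: (unliftP ord0 i) => [j|] ->.
  rewrite [X in measurable_fun _ X](_ : _ =
      (fun z : measurableTypeR R * 'rV[R]_n => z.2 ord0 j)); last first.
    by apply/funext => z; rewrite mxE liftK.
  exact: (measurableT_comp (measurable_coord j) measurable_snd).
rewrite [X in measurable_fun _ X](_ : _ = fst); first exact: measurable_fst.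
by apply/funext => z; rewrite mxE unlift_none.
Qed.

#[local] Hint Extern 0 (measurable_fun _ (@consrV _)) =>
  solve [exact: measurable_consrV] : core.

Lemma consrVK n (x : 'rV[R]_n.+1) :
  consrV (x ord0 ord0, \row_j x ord0 (lift ord0 j)) = x.
Proof.
apply/rowP => i; rewrite mxE; case: unliftP => [j|] -> //=.
by rewrite mxE.
Qed.

Lemma consrV_inj n : injective (@consrV n).
Proof.
move=> [a x] [b y] /rowP e; congr pair.
  by have := e ord0; rewrite !mxE unlift_none.
by apply/rowP => j; have := e (lift ord0 j); rewrite !mxE liftK.
Qed.

Section step.
Variables (n : nat) (m : {sigma_finite_measure set 'rV[R]_n -> \bar R}).

Definition lebesgue_cons : set 'rV[R]_n.+1 -> \bar R :=
  pushforward (@lebesgue_measure R \x m)%E (@consrV n).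

Let lc0 : lebesgue_cons set0 = 0%E.
Proof. exact: measure0. Qed.

Let lc_ge0 A : (0 <= lebesgue_cons A)%E.
Proof. exact: measure_ge0. Qed.

Let lc_sigma_additive : semi_sigma_additive lebesgue_cons.
Proof. exact: measure_semi_sigma_additive. Qed.

HB.instance Definition _ :=
  isMeasure.Build _ _ _ lebesgue_cons lc0 lc_ge0 lc_sigma_additive.

Let lc_sigma_finite : sigma_finite setT lebesgue_cons.
Proof.
have [F TF mF] : sigma_finite setT (@lebesgue_measure R \x m)%E.
  have /sigma_finiteP[F [TF ndF Foo]] := sigma_finiteT (@lebesgue_measure R).
  have /sigma_finiteP[G [TG ndG Goo]] := sigma_finiteT m.
  exists (fun k => F k `*` G k).
    apply/seteqP; split => // -[x y] _.
    have [i _ Fx] : (\bigcup_i F i) x by rewrite -TF.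
    have [j _ Gy] : (\bigcup_i G i) y by rewrite -TG.
    exists (maxn i j) => //; split.
      by move: x Fx; exact/subsetPset/ndF/leq_maxl.
    by move: y Gy; exact/subsetPset/ndG/leq_maxr.
  move=> k; have [? ?] := Foo k; have [? ?] := Goo k.
  split; first exact: measurableX.
  by rewrite product_measure1E// lte_mul_pinfty// ge0_fin_numE.
pose uncons (x : 'rV[R]_n.+1) : measurableTypeR R * 'rV[R]_n :=
  (x ord0 ord0, \row_j x ord0 (lift ord0 j)).
have muncons : measurable_fun setT uncons.
  apply: measurable_fun_pair; first exact: measurable_coord.
  apply/measurable_rVP => i.
  rewrite [X in measurable_fun _ X](_ : _ =
      (fun x : 'rV[R]_n.+1 => x ord0 (lift ord0 i))); last first.
    by apply/funext => x; rewrite mxE.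
  exact: measurable_coord.
have consK : cancel (@consrV n) uncons.
  by move=> z; apply: consrV_inj; rewrite consrVK.
exists (fun k => uncons @^-1` F k).
  by rewrite -preimage_bigcup -TF preimage_setT.
move=> k; have [mFk Fk] := mF k; split.
  by rewrite -[X in measurable X]setTI; exact: muncons.
rewrite /lebesgue_cons /pushforward -comp_preimage.
by rewrite (_ : uncons \o _ = id)//; apply/funext => z /=; rewrite consK.
Qed.

HB.instance Definition _ :=
  Measure_isSigmaFinite.Build _ _ _ lebesgue_cons lc_sigma_finite.

End step.

Fixpoint lebesgue_rV (n : nat) : {sigma_finite_measure set 'rV[R]_n -> \bar R} :=
  if n is n'.+1 then lebesgue_cons (lebesgue_rV n') else dirac (0 : 'rV[R]_0).

Lemma lebesgue_rV_box n (A : 'I_n -> set (measurableTypeR R)) :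
  (forall i, measurable (A i)) ->
  lebesgue_rV n [set x : 'rV[R]_n | forall i, A i (x ord0 i)] =
  (\prod_i lebesgue_measure (A i))%E.
Proof.
elim: n A => [|n IHn] A mA.
  by rewrite big_ord0 /= diracE mem_set//= => -[].
have mbox : measurable
    [set x : 'rV[R]_n | forall i, A (lift ord0 i) (x ord0 i)].
  rewrite (_ : [set x | _] = \big[setI/setT]_(i < n)
      ((fun x : 'rV[R]_n => x ord0 i : measurableTypeR R) @^-1` A (lift ord0 i))).
    apply: bigsetI_measurable => i _.
    by rewrite -[X in measurable X]setTI; exact: measurable_coord.
  apply/seteqP; split => x /=.
    by move=> Ax; rewrite -bigcap_seq => i _ /=; exact: Ax.
  by rewrite -bigcap_seq => Ax i; apply: (Ax i); rewrite /= mem_index_enum.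
rewrite /= /lebesgue_cons /pushforward.
rewrite (_ : _ @^-1` _ = A ord0 `*`
    [set x : 'rV[R]_n | forall i, A (lift ord0 i) (x ord0 i)]); last first.
  apply/seteqP; split => -[a x] /=.
    move=> Aax; split; first by have := Aax ord0; rewrite mxE unlift_none.
    by move=> i; have := Aax (lift ord0 i); rewrite mxE liftK.
  by move=> [Aa Ax] i; rewrite mxE; case: unliftP => [j|] ->.
rewrite big_ord_recl -IHn//; exact: product_measure1E.
Qed.

End lebesgue_rV.
Arguments lebesgue_rV {R} n.

Section euclidean.
Context {R : realType} {N : nat}.
Implicit Types (x y : 'rV[R]_N) (r : R).

Definition dotrV x y : R := \sum_i x ord0 i * y ord0 i.

(* The library norm `|x| on row vectors is the sup norm; it is only used here
   for the topology. *)
Definition enorm x : R := Num.sqrt (dotrV x x).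

Definition eball x r : set 'rV[R]_N := [set y | enorm (y - x) < r].

Definition domain (Omega : set 'rV[R]_N) :=
  [/\ open Omega, connected Omega & Omega !=set0].

Definition compactly_contained (Omega' Omega : set 'rV[R]_N) :=
  compact (closure Omega') /\ closure Omega' `<=` Omega.

End euclidean.

(* a ^ s for a >= 0, with 0 ^ s = +oo when s < 0 (the library's powR has
   0 `^ s = 0 there). *)
Definition epow {R : realType} (a s : R) : \bar R :=
  if (a == 0) && (s < 0) then +oo%E else (a `^ s)%:E.

Section calculus.
Context {R : realType} {N : nat}.
Implicit Types (Omega : set 'rV[R]_N) (f u phi : 'rV[R]_N -> R).

Definition partial (i : 'I_N) f : 'rV[R]_N -> R := 'D_(delta_mx ord0 i) f.

Definition grad f (x : 'rV[R]_N) : 'rV[R]_N := \row_i partial i f x.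

(* f is of class C^k on the open set Omega *)
Fixpoint Ck (k : nat) Omega f : Prop :=
  if k is k'.+1 then
    (forall x, Omega x -> differentiable f x) /\
    (forall i, Ck k' Omega (partial i f))
  else forall x, Omega x -> {for x, continuous f}.

Definition critical_set u : set 'rV[R]_N := [set x | grad u x = 0].

(* phi is in C_c^infty(Omega), extended by zero outside Omega *)
Definition test_function Omega phi :=
  [/\ forall k, Ck k setT phi,
      compact (closure [set x | phi x != 0]) &
      closure [set x | phi x != 0] `<=` Omega].

Definition locally_integrable_rV Omega (g : 'rV[R]_N -> \bar R) :=
  forall K, compact K -> K `<=` Omega -> (lebesgue_rV N).-integrable K g.

(* - Delta_p u = g in Omega, in the weak sense. For p < 2 and Du x = 0 the
   vector |Du|^(p-2) Du is read as 0, which is the value powR gives it. *)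
Definition weak_pLaplace (p : R) Omega u (g : 'rV[R]_N -> R) :=
  forall phi, test_function Omega phi ->
  let flux x := enorm (grad u x) `^ (p - 2) * dotrV (grad u x) (grad phi x) in
  [/\ (lebesgue_rV N).-integrable Omega (EFin \o flux),
      (lebesgue_rV N).-integrable Omega (fun x => (g x * phi x)%:E) &
      (\int[lebesgue_rV N]_(x in Omega) (flux x)%:E =
       \int[lebesgue_rV N]_(x in Omega) (g x * phi x)%:E)%E].

Definition positive_weak_solution (p : R) Omega (f : R -> R) u :=
  [/\ Ck 1 Omega u, forall x, Omega x -> 0 < u x &
      weak_pLaplace p Omega u (f \o u)].

End calculus.

(* Only the values of f on [0, +oo[ matter. *)
Definition condF {R : realType} (f : R -> R) :=
  [/\ {within `[0, +oo[, continuous f},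
      forall s : R, 0 < s -> 0 < f s &
      forall s : R, 0 < s ->
        exists2 U : set R, nbhs s U & [lipschitz f x | x in U]].

Definition admissible_gamma {R : realType} (N : nat) (gamma : R) : Prop :=
  if (N == 2)%N then gamma = 0 else gamma < N%:R - 2.

Section estimate_S.
Context {R : realType} {N : nat}.
Implicit Types (Omega : set 'rV[R]_N) (u : 'rV[R]_N -> R) (p t gamma : R).

(* The summability estimate of Damascelli and Sciunzi with exponents t and
   gamma, for a given u in Omega; uniformity in x is over Omega'. *)
Definition estimate_S p Omega u t gamma :=
  forall Omega', open Omega' -> compactly_contained Omega' Omega ->
  exists C : R, forall x, Omega' x ->
    (\int[lebesgue_rV N]_(y in Omega')
        (epow (enorm (grad u y)) (- ((p - 1) * t)) *
         epow (enorm (x - y)) (- gamma)) <= C%:E)%E.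

End estimate_S.

Definition general_estimate_S (R : realType) (N : nat) (p t gamma : R) :=
  forall (Omega : set 'rV[R]_N) (f : R -> R) (u : 'rV[R]_N -> R),
  domain Omega -> condF f -> positive_weak_solution p Omega f u ->
  estimate_S p Omega u t gamma.

Section weighted_space.
Context {R : realType} {N : nat}.
Implicit Types (Omega : set 'rV[R]_N) (rho : 'rV[R]_N -> \bar R).

Definition distributional_grad Omega (v : 'rV[R]_N -> R)
    (G : 'rV[R]_N -> 'rV[R]_N) :=
  [/\ locally_integrable_rV Omega (EFin \o v),
      forall i, locally_integrable_rV Omega (fun x => (G x ord0 i)%:E) &
      forall phi i, test_function Omega phi ->
      (\int[lebesgue_rV N]_(x in Omega) (v x * partial i phi x)%:E =
       - \int[lebesgue_rV N]_(x in Omega) (G x ord0 i * phi x)%:E)%E].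

(* V is the weighted space H^{1,2}_rho(Omega). The space is only defined for a
   weight 0 < rho in L^1(Omega), so there is no such V for other rho. *)
Definition is_H12 Omega rho (V : set ('rV[R]_N -> R)) :=
  [/\ forall x, Omega x -> (0 < rho x)%E,
      (lebesgue_rV N).-integrable Omega rho &
      V = [set v : 'rV[R]_N -> R | [/\ measurable_fun Omega v,
        (\int[lebesgue_rV N]_(x in Omega) ((v x ^+ 2)%:E) < +oo)%E &
        exists2 G, distributional_grad Omega v G &
          (\int[lebesgue_rV N]_(x in Omega)
              (rho x * (enorm (G x) ^+ 2)%:E) < +oo)%E]]].

Definition condM (lambda0 Lambda0 kappa : R) Omega rho :=
  [/\ measurable_fun Omega rho,
      forall x, Omega x -> (0 < rho x)%E,
      {ae lebesgue_rV N, forall x, Omega x -> (lambda0%:E <= rho x)%E} &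
      forall x r, 0 < r ->
      (\int[lebesgue_rV N]_(y in eball x r `&` Omega) rho y <=
       (Lambda0 * r `^ (N%:R - 2 + kappa))%:E)%E].

End weighted_space.

(* Main.v *)
Require Import Defs.
Set Warnings "-all".
From mathcomp Require Import all_boot all_order all_algebra.
From mathcomp Require Import all_classical all_reals all_analysis measurable_realfun.
From mathcomp Require Import ring lra.

Set Implicit Arguments.
Unset Strict Implicit.
Unset Printing Implicit Defensive.
Import Order.TTheory GRing.Theory Num.Theory.
Import numFieldNormedType.Exports.

Local Open Scope classical_set_scope.
Local Open Scope ring_scope.

(** Put [q = 1 / (p - 1)], so that [q >= 1] and the conjugate exponent of [p] is
    [q + 1]. The function [u] depends on the first coordinate [t] alone, and the
    derivative of [|t|^(q+1) / (q+1)] is the signed power [sg t |t|^q], which is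
    continuous and vanishes at [0] only. Hence [|Du| = |x_1|^q]
    (lemma [enorm_grad_profile]), and since [q (p - 2) + q = 1] the nonlinear
    flux [|Du|^(p-2) Du] is the linear field [- x_1 e_1], also where [Du = 0].
    The weak equation therefore says that the integral of
    [phi + x_1 d_1 phi = d_1 (x_1 phi)] vanishes for every test function: by
    Fubini it is enough to integrate along lines parallel to the first axis,
    where this is the fundamental theorem of calculus
    (lemma [integral_axis_parts]).

    Every power of [|Du|] is a power [|x_1|^(-a)] of the distance to the
    hyperplane [x_1 = 0], and the three quantitative statements are about such
    weights: [a = sigma / (p - 1)] in (i) and [a = theta = (2 - p) / (p - 1)] in
    (ii) and (iii), with [theta < 1] if and only if [p > 3/2]. Euclidean balls
    are compared with the balls of the sup norm, which are cubes, and on a cube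
    the integral of a function of [x_1] is a one-dimensional integral times a
    power of the side (lemma [integral_ball_axis]).

    On the line, the interval (-s, s) is cut into the dyadic shells
    [s / 2^(k+1) <= |t| < s / 2^k], on which [|t|^(-a)] is constant up to a factor
    [2^a]. If [a >= 1] every shell of radius at most one contributes at least one,
    so the integral is infinite; if [0 <= a < 1] the contributions
    decrease geometrically, so it is at most a multiple of [s^(1-a)]. Outside (-s, s) the
    weight is at most [s^(-a)], so the same bound holds, up to the constant, on
    every interval of radius [s] whatever its centre, which is what condition
    (M_kappa) needs.

    For the optimality of the estimate (S), the kernel [|x - y|^(-gamma)] is
    bounded from below by a positive constant when [y] is near a critical point
    and [x] stays away from it, whatever the sign of [gamma]; so the integral in
    (S) is infinite as soon as [t >= 1]. *)


(** * Borel sets of row vectors *)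

Section Borel.
Context {R : realType}.

Lemma ball_rVE n (x : 'rV[R]_n) (s : R) : 0 < s ->
  ball x s = [set y : 'rV[R]_n | forall i, ball (x ord0 i) s (y ord0 i)].
Proof.
move=> s0; apply/seteqP; split => y /=.
  by case=> _ + i; apply.
by move=> h; split=> // i j; rewrite (ord1 i).
Qed.

Lemma ball_rVP n (x y : 'rV[R]_n) (s : R) : 0 < s ->
  ball x s y <-> (forall i, `|y ord0 i - x ord0 i| < s).
Proof.
move=> s0; rewrite ball_rVE//=; split => h i; have := h i;
  by rewrite -ball_normE /= distrC.
Qed.

Lemma measurable_ball_rV n (x : 'rV[R]_n) (s : R) : measurable (ball x s).
Proof.
have [s0|s0] := ltP 0 s; last first.
  rewrite (_ : ball x s = set0)//; apply/seteqP; split=> y //= -[].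
  by rewrite ltNge s0.
rewrite ball_rVE// (_ : [set y | _] = \big[setI/setT]_(i < n)
  ((fun y : 'rV[R]_n => y ord0 i : measurableTypeR R) @^-1` (ball (x ord0 i) s))).
  apply: bigsetI_measurable => i _.
  rewrite -[X in measurable X]setTI.
  by apply: measurable_coord => //; exact: measurable_ball.
apply/seteqP; split => y /=.
  by move=> h; rewrite -bigcap_seq => i _ /=; exact: h.
by rewrite -bigcap_seq => h i; apply: (h i); rewrite /= mem_index_enum.
Qed.

Lemma rat_approx_rV n (x : 'rV[R]_n) (e : R) : 0 < e ->
  exists q : 'rV[rat]_n, ball x e (map_mx ratr q).
Proof.
move=> e0.
have /choice[q qP] : forall i, exists q : rat, ball (x ord0 i) e (ratr q).
  move=> i.
  have [] := @dense_rat R (ball (x ord0 i) e).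
  - by exists (x ord0 i); exact: ballxx.
  - exact: ball_open.
  by move=> r [h [q _ qr]]; exists q; rewrite qr.
exists (\row_i q i); split => // i j; rewrite !mxE (ord1 i); exact: qP.
Qed.

(** The sigma-algebra on row vectors is generated by the coordinates, so that
    open sets are measurable because they are countable unions of cubes with
    rational centres. *)
Lemma measurable_open_rV n (U : set 'rV[R]_n) : open U -> measurable U.
Proof.
move=> oU.
pose Q (z : 'rV[rat]_n * nat) : set 'rV[R]_n :=
  ball (map_mx ratr z.1 : 'rV[R]_n) (z.2.+1%:R^-1 : R).
pose F z := [set y | Q z `<=` U /\ Q z y].
rewrite (_ : U = \bigcup_z F z).
  apply: countable_bigcupT_measurable; first exact: countableP.
  move=> z; have [h|h] := pselect (Q z `<=` U).
    rewrite (_ : F z = Q z); first exact: measurable_ball_rV.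
    by apply/seteqP; split => y //= [].
  by rewrite (_ : F z = set0)//; apply/seteqP; split => y //= [].
apply/seteqP; split => [x Ux|x [z _ [zU]]]; last exact: zU.
have /nbhs_ballP[e /= e0 eU] : nbhs x U by apply: open_nbhs_nbhs; split.
have [k ke] : exists k : nat, k.+1%:R^-1 < e / 2.
  have [k _ kP] := near_infty_natSinv_lt (PosNum (divr_gt0 e0 (ltr0n R 2))).
  by exists k; apply: kP => /=.
have k0 : 0 < k.+1%:R^-1 :> R by rewrite invr_gt0.
have [q qP] := rat_approx_rV x k0.
exists (q, k) => //; split => /=; last exact: ball_sym.
apply: subset_trans eU => y /= qy.
rewrite (splitr e); apply: (@ball_triangle _ _ (map_mx ratr q : 'rV[R]_n)).
  exact: (le_ball (ltW ke)).
exact: (le_ball (ltW ke)).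
Qed.

Lemma continuous_measurable_rV n (f : 'rV[R]_n -> R) :
  continuous f -> measurable_fun setT (f : _ -> measurableTypeR R).
Proof.
move=> cf; apply: (measurability _ (RGenOpens.measurableE R)) => //.
move=> _ [_ [a [b ->] <-]]; rewrite setTI; apply: measurable_open_rV.
by move/continuousP : cf; apply; exact: interval_open.
Qed.

End Borel.

(** * Euclidean balls, cubes, and functions of the first coordinate *)

Section Ball.
Context {R : realType} {n : nat}.
Implicit Types (x y : 'rV[R]_n) (r s : R).

Lemma coord_le_enorm x i : `|x ord0 i| <= enorm x.
Proof.
rewrite -sqrtr_sqr ler_sqrt ?sumr_ge0// => [|j _]; last by rewrite -expr2 sqr_ge0.
rewrite /dotrV (bigD1 i)//= -expr2 lerDl sumr_ge0// => j _.
by rewrite -expr2 sqr_ge0.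
Qed.

Lemma enorm_le x s : 0 <= s -> (forall i, `|x ord0 i| <= s) ->
  enorm x <= n%:R * s.
Proof.
move=> s0 xs; have ns0 : 0 <= n%:R * s by rewrite mulr_ge0.
rewrite -[leRHS]ger0_norm// -sqrtr_sqr ler_sqrt ?sqr_ge0//.
apply: (@le_trans _ _ (\sum_(i < n) s ^+ 2)).
  apply: ler_sum => i _; rewrite -expr2 -real_normK ?num_real//.
  by rewrite lerXn2r ?nnegrE.
rewrite sumr_const card_ord -(mulr_natl (s ^+ 2)) exprMn ler_wpM2r ?sqr_ge0//.
by rewrite -natrX ler_nat; case: (n) => // k; rewrite leq_pmulr.
Qed.

Lemma enorm0 : enorm (0 : 'rV[R]_n) = 0.
Proof.
apply/le_anti/andP; split; last exact: sqrtr_ge0.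
by rewrite -[leRHS](mulr0 n%:R) enorm_le// => i; rewrite mxE normr0.
Qed.

Lemma continuous_enorm : continuous (@enorm R n).
Proof.
move=> x; apply: (@continuous_comp _ _ _ (fun y : 'rV[R]_n => dotrV y y) Num.sqrt).
  rewrite /dotrV; apply: (continuous_big add_continuous) => i _ y.
  have cc : continuous (fun z : 'rV[R]_n => z ord0 i) by exact: coord_continuous.
  exact: (cvgM (cc y) (cc y)).
exact: sqrt_continuous.
Qed.

Lemma open_eball x r : open (eball x r).
Proof.
rewrite (_ : eball x r = (fun y => enorm (y - x)) @^-1` [set t | t < r]); last by [].
have /continuousP : continuous (fun y => enorm (y - x)).
  move=> y; apply: continuous_comp; last exact: continuous_enorm.
  by apply: (@continuousB _ _ _ id (cst x)); [exact: (fun _ => id)|exact: cst_continuous].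
by apply; exact: open_lt.
Qed.

Lemma measurable_eball x r : measurable (eball x r).
Proof. apply: measurable_open_rV; exact: open_eball. Qed.

Lemma eball_sub_ball x r : eball x r `<=` ball x r.
Proof.
move=> y yr; have r0 : 0 < r by apply: le_lt_trans yr; exact: sqrtr_ge0.
apply/ball_rVP => // i.
have := coord_le_enorm (y - x) i; rewrite !mxE => /le_lt_trans; exact.
Qed.

(** Dividing by [n.+1] rather than by [n] makes the last inequality strict and
    covers [n = 0]. *)
Lemma ball_sub_eball x r : 0 < r -> ball x (r / n.+1%:R) `<=` eball x r.
Proof.
move=> r0 y; have s0 : 0 < r / n.+1%:R by rewrite divr_gt0.
move/(ball_rVP _ _ s0) => h; rewrite /eball/=.
apply: (@le_lt_trans _ _ (n%:R * (r / n.+1%:R))).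
  by apply: enorm_le => [|i]; rewrite ?ltW// !mxE.
by rewrite mulrCA gtr_pMr// ltr_pdivrMr// mul1r ltr_nat.
Qed.

Lemma eball_center x r : 0 < r -> eball x r x.
Proof. by rewrite /eball/= subrr enorm0. Qed.

Lemma enormZ (a : R) x : enorm (a *: x) = `|a| * enorm x.
Proof.
rewrite /enorm /dotrV.
under eq_bigr do rewrite !mxE mulrACA.
by rewrite -mulr_sumr sqrtrM ?sqr_ge0// -sqrtr_sqr expr2.
Qed.

(** A ball is connected as the union of the segments that join its points to
    its centre. *)
Lemma domain_eball x r : 0 < r -> domain (eball x r).
Proof.
move=> r0; split; [exact: open_eball| |by exists x; exact: eball_center].
pose seg y := (fun t : R => x + t *: (y - x)) @` `[0, 1]%classic.
rewrite (_ : eball x r = \bigcup_(y in eball x r) seg y).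
  apply: bigcup_connected.
    exists x => y _; exists 0; last by rewrite scale0r addr0.
    by rewrite /= in_itv/= lexx ler01.
  move=> y _; have cs : continuous (fun t : R => x + t *: (y - x)).
    move=> t; apply: (@continuousD R 'rV[R]_n R (cst x) (fun t : R => t *: (y - x)) t).
      exact: cst_continuous.
    exact: scalel_continuous.
  apply: connected_continuous_connected; first exact: segment_connected.
  exact: continuous_subspaceT cs.
apply/seteqP; split => [y yr|z [y yr [t /=]]].
  exists y => //; exists 1; last by rewrite scale1r addrC subrK.
  by rewrite /= in_itv/= lexx ler01.
rewrite in_itv/= => /andP[t0 t1] <-; rewrite /eball/= addrC addKr enormZ ger0_norm//.
by rewrite (le_lt_trans _ yr)// ler_piMl// sqrtr_ge0.
Qed.

End Ball.

Section Cube.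
Context {R : realType}.

Lemma consrV_preimage_ball n (x : 'rV[R]_n.+1) (s : R) : 0 < s ->
  @consrV R n @^-1` (ball x s) =
  ball (x ord0 ord0) s `*` ball (\row_j x ord0 (lift ord0 j)) s.
Proof.
move=> s0; apply/seteqP; split => -[a z].
  move=> /(ball_rVP _ _ s0) h; split.
    by have := h ord0; rewrite mxE unlift_none /= -ball_normE/= distrC.
  by apply/ball_rVP => // i; have := h (lift ord0 i); rewrite !mxE liftK.
move=> [/= xa /(ball_rVP _ _ s0) h]; apply/ball_rVP => // i.
rewrite mxE; case: unliftP => [j|] -> /=; first by have := h j; rewrite mxE.
by move: xa; rewrite -ball_normE/= distrC.
Qed.

Lemma lebesgue_rV_ball n (x : 'rV[R]_n) (s : R) : 0 < s ->
  lebesgue_rV n (ball x s) = ((s *+ 2) ^+ n)%:E.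
Proof.
move=> s0; rewrite ball_rVE// (@lebesgue_rV_box _ _ (fun i => ball (x ord0 i) s)).
  under eq_bigr do rewrite lebesgue_measure_ball ?ltW//.
  by rewrite prodEFin prodr_const card_ord.
by move=> i; exact: measurable_ball.
Qed.

Local Open Scope ereal_scope.

(** The reduction to one dimension: the Lebesgue measure is a pushforward of the
    product of the line and the remaining coordinates, and a ball of the sup norm
    is a product of balls. *)
Lemma integral_ball_axis n (h : measurableTypeR R -> \bar R) (x : 'rV[R]_n.+1) (s : R) :
  (0 < s)%R -> measurable_fun setT h -> (forall t, 0 <= h t) ->
  \int[lebesgue_rV n.+1]_(y in ball x s) h (y ord0 ord0) =
  \int[lebesgue_measure]_(t in ball (x ord0 ord0) s) h t * ((s *+ 2) ^+ n)%:E.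
Proof.
move=> s0 mh h0.
have mh0 : measurable_fun setT (fun y : 'rV[R]_n.+1 => h (y ord0 ord0)).
  exact: (measurableT_comp mh (measurable_coord ord0)).
transitivity (\int[pushforward (lebesgue_measure \x lebesgue_rV n)
    (@consrV R n)]_(y in ball x s) h (y ord0 ord0)); first by [].
rewrite ge0_integral_pushforward//; first last.
- exact: measurable_funTS.
- exact: measurable_ball_rV.
- exact: measurable_consrV.
rewrite consrV_preimage_ball// integral_mkcond.
set B := ball (\row_j _) s.
have mB : measurable B by exact: measurable_ball_rV.
have mA : measurable (ball (x ord0 ord0) s : set (measurableTypeR R)).
  exact: measurable_ball.
rewrite fubini_tonelli1/=; last 2 first.
- apply/(measurable_restrictT _ (measurableX mA mB)).
  apply: measurable_funTS; exact: (measurableT_comp mh0 (@measurable_consrV R n)).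
- by move=> z; apply: erestrict_ge0 => z' _ /=; exact: h0.
rewrite -(lebesgue_rV_ball (\row_j x ord0 (lift ord0 j)) s0) -/B.
rewrite -ge0_integralZr//; [|exact: measurable_funTS].
rewrite [RHS]integral_mkcond; apply: eq_integral => t _.
rewrite patchE /fubini_F; case: ifPn => tA; last first.
  apply: integral0_eq => y _; rewrite patchE; case: ifPn => // /[!inE] -[/= h1].
  by rewrite (mem_set h1) in tA.
rewrite -integral_cst// [RHS]integral_mkcond; apply: eq_integral => y _.
rewrite !patchE in_setX tA/=; case: ifPn => //= _.
by rewrite mxE unlift_none.
Qed.

End Cube.

(** * Powers of the absolute value on the line *)

Section Epow.
Context {R : realType}.
Implicit Types (a b s t : R).

Lemma epow_gt0E t s : 0 < t -> epow t s = (t `^ s)%:E.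
Proof. by move=> t0; rewrite /epow gt_eqF. Qed.

Lemma epow_ge0 t s : (0 <= epow t s)%E.
Proof. by rewrite /epow; case: ifPn => // _; rewrite lee_fin powR_ge0. Qed.

(** Both sides are infinite together, as [s > 0]; this is what turns powers of
    the gradient into powers of the first coordinate. *)
Lemma epow_powR t s a : 0 <= t -> 0 < s -> epow (t `^ s) a = epow t (s * a).
Proof.
move=> t0 s0; rewrite /epow powR_eq0 (gt_eqF s0) andbT pmulr_rlt0//.
by rewrite powRrM.
Qed.

Lemma ler_powRN a s t : 0 <= a -> 0 < s -> s <= t -> t `^ (- a) <= s `^ (- a).
Proof.
move=> a0 s0 st; rewrite !powRN lef_pV2 ?posrE ?powR_gt0//; last exact: lt_le_trans st.
by rewrite ge0_ler_powR ?nnegrE ?(ltW s0)// (le_trans (ltW s0)).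
Qed.

Lemma lee_epowN a s t : 0 <= a -> 0 <= s -> s <= t -> 0 < t ->
  ((t `^ (- a))%:E <= epow s (- a))%E.
Proof.
move=> a0 s0 st t0; rewrite /epow; case: ifPn => [_|]; first exact: leey.
rewrite lee_fin negb_and => /orP[sn0|].
  by apply: ler_powRN => //; rewrite lt_neqAle eq_sym sn0.
rewrite oppr_lt0 -leNgt => a1.
by rewrite (le_anti (introT andP (conj a1 a0))) oppr0 !powRr0.
Qed.

Lemma measurable_epow_norm s :
  measurable_fun setT (fun t : measurableTypeR R => epow `|t| s).
Proof.
have [s0|s0] := ltP s 0; last first.
  rewrite (_ : (fun _ => _) = EFin \o (fun t : R => `|t| `^ s)).
    apply: measurableT_comp => //; apply: (measurableT_comp (@measurable_powR R s)).
    exact: normr_measurable.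
  by apply/funext => t; rewrite /epow ltNge s0 andbF.
rewrite (_ : (fun _ => _) = (fun t : R => if t == 0 then +oo%E else (`|t| `^ s)%:E)).
  apply: measurable_fun_ifT => //.
    exact: measurable_fun_eqr.
  apply: measurableT_comp => //; apply: (measurableT_comp (@measurable_powR R s)).
  exact: normr_measurable.
by apply/funext => t; rewrite /epow s0 andbT normr_eq0.
Qed.

End Epow.

Section Power.
Context {R : realType}.
Notation mu := (@lebesgue_measure R).
Local Notation B := (ball (0 : R)).

Let mB s : measurable (B s : set (measurableTypeR R)). Proof. exact: measurable_ball. Qed.
Let mS s r : measurable (B s `\` B r : set (measurableTypeR R)).
Proof. exact: measurableD. Qed.
Let mw a (D : set (measurableTypeR R)) :
  measurable_fun D (fun t : R => epow `|t| (- a)).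
Proof. apply: measurable_funTS; exact: measurable_epow_norm. Qed.
#[local] Hint Resolve mB mS mw : core.

Let ltB s t : `|t| < s -> B s t.
Proof. by rewrite -ball_normE /ball_/= sub0r normrN. Qed.
Let Blt s t : B s t -> `|t| < s.
Proof. by rewrite -ball_normE /ball_/= sub0r normrN. Qed.
Let BNge s t : ~ B s t -> s <= `|t|.
Proof. by move=> h; rewrite leNgt; apply/negP => /ltB. Qed.

Lemma lebesgue_measure_shell (s : R) : 0 < s -> mu (B s `\` B (s / 2)) = s%:E.
Proof.
move=> s0; have sub : B (s / 2) `<=` B s.
  by apply: le_ball; rewrite ler_piMr ?(ltW s0)// invf_le1 ?ler1n.
transitivity (mu (B s) - mu (B s `&` B (s / 2)))%E.
  apply: measureD; [exact: mB|exact: mB|].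
  by rewrite [ltLHS]lebesgue_measure_ball ?ltW// ltry.
rewrite setIidr//.
rewrite !lebesgue_measure_ball ?divr_ge0 ?(ltW s0)// -EFinB.
by congr EFin; rewrite !mulr2n -splitr addrK.
Qed.

Local Open Scope ereal_scope.

Lemma integral_epow_halve (a s : R) : (0 < s)%R ->
  \int[mu]_(t in B s) epow `|t| (- a) =
  \int[mu]_(t in B s `\` B (s / 2)) epow `|t| (- a) +
  \int[mu]_(t in B (s / 2)) epow `|t| (- a).
Proof.
move=> s0; rewrite -ge0_integral_setU//; last 2 first.
- by move=> t _; exact: epow_ge0.
- by apply/disj_setPS => t [[_ h] /h].
congr integral; rewrite setUC setDUK//.
by apply: le_ball; rewrite ler_piMr ?(ltW s0)// invf_le1 ?ler1n.
Qed.

(** The shell between [r / 2] and [r <= 1] has measure [r] and the weight is at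
    least [1 / r] on it, so that doubling the radius gains at least one. Iterating,
    the integral exceeds every integer. *)
Lemma integral_epow_pinfty (a s : R) : (1 <= a)%R -> (0 < s)%R ->
  \int[mu]_(t in B s) epow `|t| (- a) = +oo.
Proof.
move=> a1 s0.
have step (r : R) : (0 < r)%R -> (r <= 1)%R ->
    1 + \int[mu]_(t in B (r / 2)) epow `|t| (- a) <=
    \int[mu]_(t in B r) epow `|t| (- a).
  move=> r0 r1; rewrite [leRHS]integral_epow_halve//; apply: leeD => //.
  rewrite (_ : 1 = (r^-1)%:E * mu (B r `\` B (r / 2))); last first.
    by rewrite lebesgue_measure_shell// -EFinM mulVf ?gt_eqF.
  rewrite -integral_cst//; apply: ge0_le_integral => //.
  - by move=> t _; rewrite lee_fin invr_ge0 ltW.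
  - move=> t [/Blt tr /BNge rt].
    have t0 : (0 < `|t|)%R by apply: lt_le_trans rt; rewrite divr_gt0.
    rewrite epow_gt0E// lee_fin; apply: (@le_trans _ _ (`|t|^-1)%R).
      by rewrite lef_pV2 ?posrE// ltW.
    rewrite -[leLHS]powR_inv1 ?(ltW t0)// ger_powR ?lerN2//.
    by rewrite t0 (le_trans (ltW tr)).
have grow (k : nat) (r : R) : (0 < r)%R -> (r <= 1)%R ->
    (k%:R)%:E <= \int[mu]_(t in B r) epow `|t| (- a).
  elim: k r => [|k ih] r r0 r1; first by apply: integral_ge0 => t _; exact: epow_ge0.
  apply: le_trans (step r r0 r1); rewrite -natr1 EFinD addeC leeD// ih ?divr_gt0//.
  by rewrite ler_pdivrMr// mul1r (le_trans r1)// ler1n.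
have small : \int[mu]_(t in B (Num.min s 1%R)) epow `|t| (- a) = +oo.
  apply/eqyP => x x0; apply: le_trans (grow (Num.truncn x).+1 _ _ _).
  - by rewrite lee_fin ltW// truncnS_gt.
  - by rewrite lt_min s0 ltr01.
  - by rewrite ge_min lexx orbT.
apply/eqP; rewrite -leye_eq -small; apply: ge0_subset_integral => //.
- by move=> t _; exact: epow_ge0.
- by apply: le_ball; rewrite ge_min lexx.
Qed.

(** One shell contributes at most [2^a s^(1-a)] and passing to the next one
    multiplies this by [2^(a-1) < 1]: the constant is the sum of this geometric
    series. It is the fixed point of [C |-> 2^a + C 2^(a-1)], so that an induction
    on the number of shells can replace the summation. *)
Lemma integral_epow_ball0 (a s : R) : (0 <= a < 1)%R -> (0 < s)%R ->
  \int[mu]_(t in B s) epow `|t| (- a) <=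
  (2 `^ a / (1 - 2 `^ (a - 1)) * s `^ (1 - a))%:E.
Proof.
move=> /andP[a0 a1] s0.
set C := (2 `^ a / _)%R.
have q1 : (2 `^ (a - 1) < 1 :> R)%R.
  have -> : (a - 1 = - (1 - a))%R by rewrite opprB.
  rewrite powRN invf_lt1 ?powR_gt0//.
  have e1 : (1 `^ (1 - a) = 1 :> R)%R by rewrite powR1.
  rewrite -[ltLHS]e1 gt0_ltr_powR ?nnegrE ?subr_gt0//.
  by rewrite ltr1n.
have C0 : (0 <= C)%R by rewrite divr_ge0 ?powR_ge0// subr_ge0 ltW.
have CE : (2 `^ a + C * 2 `^ (a - 1) = C)%R.
  by rewrite /C; field; rewrite gt_eqF// subr_gt0.
pose A k (r : R) := B r `\` B (r / 2 ^+ k).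
have mA k r : measurable (A k r : set (measurableTypeR R)) by exact: mS.
have shell (r : R) : (0 < r)%R ->
    \int[mu]_(t in B r `\` B (r / 2)) epow `|t| (- a) <= (2 `^ a * r `^ (1 - a))%:E.
  move=> r0; have r20 : (0 < r / 2)%R by rewrite divr_gt0.
  apply: (@le_trans _ _ (\int[mu]_(t in B r `\` B (r / 2)) ((r / 2) `^ (- a))%:E)).
    apply: ge0_le_integral => //.
    - by move=> t _; exact: epow_ge0.
    - move=> t [/Blt tr /BNge rt].
      by rewrite epow_gt0E ?(lt_le_trans r20)// lee_fin ler_powRN.
  rewrite integral_cst// [X in _ * X]lebesgue_measure_shell// -EFinM lee_fin.
  rewrite powRM ?invr_ge0 ?(ltW r0)// -(powR_inv1 (ler0n R 2)) -powRrM mulrN mulN1r opprK.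
  rewrite powRD; last by rewrite (gt_eqF r0) implybT.
  rewrite powRr1 ?(ltW r0)// le_eqVlt; apply/orP; left; apply/eqP; ring.
have finite k (r : R) : (0 < r)%R ->
    \int[mu]_(t in A k r) epow `|t| (- a) <= (C * r `^ (1 - a))%:E.
  elim: k r => [|k ih] r r0.
    by rewrite /A expr0 divr1 setDv integral_set0 lee_fin mulr_ge0 ?powR_ge0.
  have r20 : (0 < r / 2)%R by rewrite divr_gt0.
  have -> : A k.+1 r = (B r `\` B (r / 2)%R) `|` A k (r / 2)%R.
    rewrite /A exprS invfM mulrA; apply/seteqP; split => t.
      move=> [h1 h2]; have [h|h] := pselect (B (r / 2)%R t); last by left.
      by right.
    move=> [[h1 h2]|[h1 h2]]; split => //.
    - move=> h; apply: h2; apply: le_ball h.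
      rewrite ler_piMr ?(ltW r20)// invf_le1 ?exprn_gt0//.
      by rewrite exprn_ege1// ler1n.
    - apply: le_ball h1; rewrite ler_piMr ?(ltW r0)// invf_le1 ?ler1n//.
  rewrite ge0_integral_setU//; last 2 first.
  - by move=> t _; exact: epow_ge0.
  - by apply/disj_setPS => t [[_ h] [/h]].
  apply: le_trans (leeD (shell r r0) (ih _ r20)) _.
  rewrite -EFinD lee_fin powRM ?invr_ge0 ?(ltW r0)//.
  rewrite -(powR_inv1 (ler0n R 2)) -powRrM mulN1r opprB.
  rewrite -[in leRHS]CE le_eqVlt; apply/orP; left; apply/eqP; clearbody C; ring.
have -> : \int[mu]_(t in B s) epow `|t| (- a) =
    \int[mu]_(t in B s `\` [set (0 : R)%R]) epow `|t| (- a).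
  apply: ge0_negligible_integral => //.
  - by move=> t _; exact: epow_ge0.
  - exact: lebesgue_measure_set1.
have -> : B s `\` [set 0%R] = \bigcup_k A k s.
  apply/seteqP; split => t.
    move=> [Bt t0]; have t1 : (0 < `|t|)%R by rewrite normr_gt0; apply/eqP.
    have [k kP] : exists k, (s / 2 ^+ k < `|t|)%R.
      have [k _ kP] := near_infty_natSinv_expn_lt (PosNum (divr_gt0 t1 s0)).
      exists k; have := kP k (leqnn k) => /=.
      by rewrite ltr_pdivlMr// mulrC mul1r.
    by exists k => //; split => // /Blt; rewrite ltNge ltW.
  move=> [j _ [h1 h2]]; split => // t0; apply: h2.
  by apply: ltB; rewrite t0 normr0 divr_gt0// exprn_gt0.
have ndA : nondecreasing_seq (fun k => A k s).
  apply/nondecreasing_seqP => k; rewrite subsetEset => t [h1 h2]; split=> // h; apply: h2.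
  apply: le_ball h; rewrite exprS invfM mulrA ler_wpM2r ?invr_ge0 ?exprn_ge0//.
  by rewrite ler_piMr ?(ltW s0)// invf_le1 ?ler1n.
have cv : \int[mu]_(t in A i s) epow `|t| (- a) @[i --> \oo] -->
    \int[mu]_(t in \bigcup_i A i s) epow `|t| (- a).
  by apply: ge0_nondecreasing_set_cvg_integral => // k t _; exact: epow_ge0.
move/cvg_lim : (cv) => <-//; apply: lime_le.
  by apply/cvg_ex; eexists; exact: cv.
by apply: nearW => k; exact: finite.
Qed.

(** The constant does not depend on the centre: outside (-s, s) the weight is
    at most [s^(-a)], which contributes at most [2 s^(1-a)]. *)
Lemma integral_epow_ball (a : R) : (0 <= a < 1)%R ->
  exists2 C : R, (0 < C)%R & forall t0 s : R, (0 < s)%R ->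
    \int[mu]_(t in ball t0 s) epow `|t| (- a) <= (C * s `^ (1 - a))%:E.
Proof.
move=> a01; have /andP[a0 a1] := a01.
set C := (2 `^ a / (1 - 2 `^ (a - 1)))%R.
have C0 : (0 <= C)%R.
  (* the bound at radius one is C itself *)
  have := integral_epow_ball0 a01 ltr01; rewrite powR1 mulr1 -/C -lee_fin.
  apply: le_trans.
  by apply: integral_ge0 => t _; exact: epow_ge0.
exists (C + 2)%R => [|t0 s s0]; first by rewrite ltr_wpDl.
have mb : measurable (ball t0 s : set (measurableTypeR R)) by exact: measurable_ball.
have mD : measurable (ball t0 s `\` B s : set (measurableTypeR R)) by exact: measurableD.
apply: (@le_trans _ _ (\int[mu]_(t in B s `|` (ball t0 s `\` B s)) epow `|t| (- a))).
  apply: ge0_subset_integral => //.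
  - by apply: measurableU => //; exact: measurableD.
  - by move=> t _; exact: epow_ge0.
  - by move=> t h; have [|] := pselect (B s t); [left|right].
rewrite ge0_integral_setU//; last 2 first.
- by move=> t _; exact: epow_ge0.
- by apply/disj_setPS => t [h [_ /(_ h)]].
rewrite mulrDl EFinD; apply: leeD; first exact: integral_epow_ball0.
apply: (@le_trans _ _ (\int[mu]_(t in ball t0 s `\` B s) (s `^ (- a))%:E)).
  apply: ge0_le_integral => //.
  - by move=> t _; exact: epow_ge0.
  - move=> t [_ /BNge st].
    by rewrite epow_gt0E ?(lt_le_trans s0)// lee_fin ler_powRN.
rewrite integral_cst; last exact: mD.
apply: (@le_trans _ _ ((s `^ (- a))%:E * mu (ball t0 s))).
  rewrite lee_wpmul2l ?lee_fin ?powR_ge0//; apply: le_measure; rewrite ?inE//.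
rewrite [X in _ * X <= _]lebesgue_measure_ball ?(ltW s0)// -EFinM lee_fin.
rewrite powRD; last by rewrite (gt_eqF s0) implybT.
by rewrite powRr1 ?(ltW s0)// le_eqVlt; apply/orP; left; apply/eqP; ring.
Qed.

End Power.

(** * Signed powers and the explicit solution *)

Section SignedPower.
Context {R : realType}.
Implicit Types (q t : R).

(** The odd extension of [t^q] to the line; up to the factor [q + 1] it is the
    derivative of the even function [|t|^(q+1)]. *)
Definition spowR q t := Num.sg t * `|t| `^ q.

Lemma normr_spowR q t : 0 < q -> `|spowR q t| = `|t| `^ q.
Proof.
move=> q0; have [->|t0] := eqVneq t 0.
  by rewrite /spowR sgr0 mul0r !normr0 powR0// gt_eqF.
by rewrite /spowR normrM normr_sg t0 mul1r ger0_norm// powR_ge0.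
Qed.

Lemma spowRN q t : spowR q (- t) = - spowR q t.
Proof. by rewrite /spowR sgrN normrN mulNr. Qed.

Lemma spowR_gt0 q t : 0 < t -> spowR q t = t `^ q.
Proof. by move=> t0; rewrite /spowR gtr0_sg// mul1r gtr0_norm. Qed.

Lemma spowR0 q : spowR q 0 = 0. Proof. by rewrite /spowR sgr0 mul0r. Qed.

Lemma spowRS q t : 0 < q -> spowR q t * t = `|t| `^ (q + 1).
Proof.
move=> q0; have [->|t0] := eqVneq t 0.
  by rewrite mulr0 normr0 powR0// gt_eqF// addr_gt0.
rewrite powRD; last by rewrite normr_eq0 t0 implybT.
by rewrite powRr1// /spowR mulrAC mulrC -normrEsg.
Qed.

Lemma continuous_spowR q : 1 <= q -> continuous (spowR q).
Proof.
move=> q1; have q0 : 0 < q by apply: lt_le_trans q1.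
have pos (t : R) : 0 < t -> {for t, continuous (spowR q)}.
  move=> t0; have cs : {for t, continuous (fun s : R => s `^ q)}.
    apply/differentiable_continuous/derivable1_diffP.
    by have [] := is_derive1_powR q t0.
  rewrite /prop_for /continuous_at spowR_gt0//; apply: cvg_trans cs; apply: near_eq_cvg.
  near=> s; rewrite spowR_gt0//; near: s; exact: lt_nbhsr.
move=> t; have [t0|t0|->] := ltgtP t 0; last 2 first.
- exact: pos.
- rewrite /continuous_at spowR0; apply/cvgr0Pnorm_le => e e0.
  near=> s; rewrite normr_spowR//.
  have s1 : `|s| <= Num.min 1 e.
    near: s; apply: cvgr0_norm_le; last by rewrite lt_min ltr01.
    exact: (fun _ => id).
  have [->|s0] := eqVneq s 0; first by rewrite normr0 powR0 ?gt_eqF// ltW.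
  move: s1; rewrite le_min => /andP[s1 se]; apply: le_trans se.
  by rewrite ge1r_powR// normr_gt0 s0.
have -> : spowR q = -%R \o (spowR q \o -%R).
  by apply/funext => s /=; rewrite spowRN opprK.
apply: continuous_comp; last exact: opp_continuous.
apply: continuous_comp; first exact: opp_continuous.
by apply: pos; rewrite oppr_gt0.
Unshelve. all: by end_near. Qed.

(** At the origin, where the chain rule does not apply, the factorization
    [|t|^(q+1) = (sg t |t|^q) t] is a Caratheodory form of the derivative; the negative half line follows by parity. *)
Lemma is_derive_powR_norm q t : 1 <= q ->
  is_derive t 1 (fun s : R => `|s| `^ (q + 1)) ((q + 1) * spowR q t).
Proof.
move=> q1; have q0 : 0 < q by apply: lt_le_trans q1.
have pos (s : R) : 0 < s ->
    is_derive s 1 (fun s : R => `|s| `^ (q + 1)) ((q + 1) * spowR q s).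
  move=> s0; rewrite spowR_gt0//.
  apply: (@near_eq_is_derive R R R (fun s : R => s `^ (q + 1))).
    near=> r; rewrite gtr0_norm//; near: r; exact: lt_nbhsr.
  by have := is_derive1_powR (q + 1) s0; rewrite addrK.
have [t0|t0|->] := ltgtP t 0; last 2 first.
- exact: pos.
- rewrite spowR0 mulr0; apply/is_derive1_caratheodory; exists (spowR q); split.
  + move=> z; rewrite subr0 spowRS// normr0 powR0 ?subr0// gt_eqF// addr_gt0//.
  + exact: continuous_spowR.
  + exact: spowR0.
have Nt : 0 < - t by rewrite oppr_gt0.
rewrite (_ : (fun _ => _) = (fun s : R => `|s| `^ (q + 1)) \o -%R); last first.
  by apply/funext => s /=; rewrite normrN.
have d := pos _ Nt.
have -> : (q + 1) * spowR q t = (q + 1) * spowR q (- t) * -1.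
  by rewrite spowRN mulrN1 mulrN opprK.
exact: is_derive1_comp.
Unshelve. all: by end_near. Qed.

End SignedPower.

Section Axis.
Context {R : realType}.

(** The difference quotients of the two sides are the same functions. *)
Lemma derive_axis n (f : R -> R) (v x : 'rV[R]_n.+1) :
  'D_v (fun y : 'rV[R]_n.+1 => f (y ord0 ord0)) x = 'D_(v ord0 ord0) f (x ord0 ord0).
Proof.
rewrite /derive; set F := (fun h : R => _); set G := (fun h : R => _).
by have -> : F = G by apply/funext => h; rewrite /F /G /= !mxE.
Qed.

Lemma partial_axis n (f : R -> R) (df : R) (i : 'I_n.+1) (x : 'rV[R]_n.+1) :
  is_derive (x ord0 ord0) 1 f df ->
  partial i (fun y : 'rV[R]_n.+1 => f (y ord0 ord0)) x = if i == ord0 then df else 0.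
Proof.
move=> fd; rewrite /partial derive_axis mxE eqxx /= eq_sym.
by case: eqVneq => [|] _ ; [exact: derive_val | exact: derive0].
Qed.

Lemma differentiable_axis n (f : R -> R) (x : 'rV[R]_n.+1) :
  derivable f (x ord0 ord0) 1 ->
  differentiable (fun y : 'rV[R]_n.+1 => f (y ord0 ord0)) x.
Proof.
move=> /derivable1_diffP df.
apply: (@differentiable_comp _ _ _ _ (fun y : 'rV[R]_n.+1 => y ord0 ord0) f) => //.
exact: differentiable_coord.
Qed.

Lemma continuous_axis n (f : R -> R) :
  continuous f -> continuous (fun y : 'rV[R]_n.+1 => f (y ord0 ord0)).
Proof.
move=> cf y; apply: (@continuous_comp _ _ _ (fun y : 'rV[R]_n.+1 => y ord0 ord0) f).
  exact: coord_continuous.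
exact: cf.
Qed.

End Axis.

Section Profile.
Context {R : realType} {n : nat}.
Context (q c : R) (q1 : 1 <= q).

(** The function [u] of the theorem is [profile q c] for [q = 1 / (p - 1)], since
    [p / (p - 1) = q + 1]. *)
Definition profile (x : 'rV[R]_n.+1) := c - `|x ord0 ord0| `^ (q + 1) / (q + 1).

Lemma is_derive_profile (t : R) :
  is_derive t 1 (fun s : R => c - `|s| `^ (q + 1) / (q + 1)) (- spowR q t).
Proof.
have h := is_derive_powR_norm t q1.
have q0 : q + 1 != 0 by rewrite gt_eqF// addr_gt0// (lt_le_trans _ q1).
apply: is_derive_eq.
rewrite !scaler0 !add0r mul1r; congr (- _); exact: mulKf.
Qed.

Lemma partial_profile i x :
  partial i profile x = if i == ord0 then - spowR q (x ord0 ord0) else 0.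
Proof. exact: (partial_axis i (is_derive_profile (x ord0 ord0))). Qed.

Lemma Ck1_profile (Omega : set 'rV[R]_n.+1) : Ck 1 Omega profile.
Proof.
split=> [x _|i x _].
  apply: (@differentiable_axis R n (fun s : R => c - `|s| `^ (q + 1) / (q + 1))).
  by have [] := is_derive_profile (x ord0 ord0).
rewrite (_ : partial i profile =
    fun x => (if i == ord0 then - spowR q (x ord0 ord0) else 0)).
  case: eqP => _; last exact: cst_continuous.
  apply: (@continuous_axis _ _ (fun t => - spowR q t)) => t.
  apply: continuous_comp; [exact: continuous_spowR|exact: opp_continuous].
by apply/funext => y; exact: partial_profile.
Qed.

Lemma dotr_grad_profile (x y : 'rV[R]_n.+1) :
  dotrV (grad profile x) y = - spowR q (x ord0 ord0) * y ord0 ord0.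
Proof.
rewrite /dotrV (bigD1 ord0)//= big1 ?addr0 => [|i /negPf i0].
  by rewrite !mxE partial_profile eqxx.
by rewrite !mxE partial_profile i0 mul0r.
Qed.

Lemma enorm_grad_profile x : enorm (grad profile x) = `|x ord0 ord0| `^ q.
Proof.
rewrite /enorm dotr_grad_profile !mxE partial_profile eqxx -expr2 sqrtr_sqr normrN.
by rewrite normr_spowR// (lt_le_trans _ q1).
Qed.

Lemma critical_set_profile : critical_set profile = [set x | x ord0 ord0 = 0].
Proof.
apply/seteqP; split => x /=.
  move=> /rowP/(_ ord0); rewrite !mxE partial_profile eqxx => /eqP.
  rewrite oppr_eq0 -normr_eq0 normr_spowR ?(lt_le_trans _ q1)//.
  by move=> /eqP/powR_eq0_eq0/normr0_eq0.
move=> x0; apply/rowP => i; rewrite !mxE partial_profile x0 spowR0 oppr0.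
by case: ifP.
Qed.

End Profile.

(** * Integration by parts along the first axis *)

Section Fubini.
Context {R : realType}.

Lemma bounded_sub_ball n (A : set 'rV[R]_n) : bounded_set A ->
  exists2 M : R, 0 < M & A `<=` ball (0 : 'rV[R]_n) M.
Proof.
move=> [M [_ hM]]; exists (`|M| + 2); first by rewrite ltr_wpDl.
move=> x Ax; rewrite mx_norm_ball /ball_ /= sub0r normrN.
apply: (@le_lt_trans _ _ (`|M| + 1)); last by rewrite ltrD2l ltr1n.
by apply: hM => //; rewrite (le_lt_trans (ler_norm M))// ltrDl.
Qed.

(** Both sides of the weak equation are integrals of such functions. *)
Lemma integrable_continuous_compact n (f : 'rV[R]_n -> R) (K : set 'rV[R]_n) :
  continuous f -> compact K -> (forall x, ~ K x -> f x = 0) ->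
  (lebesgue_rV n).-integrable setT (EFin \o f).
Proof.
move=> cf cK fK.
have [M M0 KM] : exists2 M : R, 0 < M & K `<=` ball (0 : 'rV[R]_n) M.
  exact: bounded_sub_ball (compact_bounded cK).
have mB : measurable (ball (0 : 'rV[R]_n) M) by exact: measurable_ball_rV.
have -> : EFin \o f = (EFin \o f) \_ (ball (0 : 'rV[R]_n) M).
  apply/funext => x; rewrite patchE; case: ifPn => // /negP xB /=.
  by rewrite fK// => /KM h; apply: xB; rewrite inE.
apply: (integrable_mkcond _ mB).1; apply: measurable_bounded_integrable => //.
- by rewrite [ltLHS]lebesgue_rV_ball// ltry.
- by apply: measurable_funTS; exact: continuous_measurable_rV.
- have [C [_ hC]] := compact_bounded (continuous_compact (continuous_subspaceT cf) cK).
  exists `|C|; split; first exact: num_real.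
  move=> D CD x _ /=; have [Kx|nKx] := pselect (K x).
    by apply: hC => //; exact: le_lt_trans (ler_norm _) CD.
  by rewrite fK// normr0 (le_trans (normr_ge0 C))// ltW.
Qed.

Local Open Scope ereal_scope.

Lemma integral_consrV n (f : 'rV[R]_n.+1 -> \bar R) :
  (lebesgue_rV n.+1).-integrable setT f ->
  \int[lebesgue_rV n.+1]_x f x =
  \int[lebesgue_rV n]_y \int[lebesgue_measure]_t f (consrV (t : measurableTypeR R, y)).
Proof.
move=> intf; have mf := measurable_int _ intf.
have mfc : measurable_fun setT (f \o @consrV R n).
  exact: (measurableT_comp mf (@measurable_consrV R n)).
have intfc : (lebesgue_measure \x lebesgue_rV n).-integrable setT (f \o @consrV R n).
  apply/integrableP; split => //.
  move/integrableP : (intf) => [_]; apply: le_lt_trans.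
  rewrite (_ : \int[lebesgue_rV n.+1]_x `|f x| =
    \int[pushforward (lebesgue_measure \x lebesgue_rV n) (@consrV R n)]_x `|f x|);
    last by [].
  rewrite ge0_integral_pushforward//.
  - exact: measurable_consrV.
  - exact: measurableT_comp.
rewrite (integral21_prod_meas1 intfc).
rewrite (_ : \int[lebesgue_rV n.+1]_x f x =
    \int[pushforward (lebesgue_measure \x lebesgue_rV n) (@consrV R n)]_x f x);
    last by [].
rewrite integral_pushforward//.
exact: measurable_consrV.
Qed.

End Fubini.

Section WeakForm.
Context {R : realType} {n : nat}.
Local Notation N := n.+1.
Implicit Types (phi : 'rV[R]_N -> R) (Omega : set 'rV[R]_N).

Let line (y : 'rV[R]_n) (t : R) : 'rV[R]_N := consrV (t : measurableTypeR R, y).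

Let lineD y (h t : R) : line y (h *: 1 + t) = h *: delta_mx ord0 ord0 + line y t.
Proof.
apply/rowP => i; rewrite /line !mxE; case: unliftP => [j|] -> /=.
  by rewrite mulr0 add0r.
by [].
Qed.

Let line0 y t : line y t ord0 ord0 = t.
Proof. by rewrite mxE unlift_none. Qed.

Let continuous_line y : continuous (line y).
Proof.
have -> : line y = (fun t : R => t *: delta_mx ord0 ord0 + line y 0).
  by apply/funext => t; rewrite -lineD addr0 /GRing.scale /= mulr1.
move=> t.
apply: (@continuousD R 'rV[R]_N R (fun t : R => t *: delta_mx ord0 ord0) (cst _) t).
  exact: scalel_continuous.
exact: cst_continuous.
Qed.

Lemma is_derive_line phi y (t : R) : differentiable phi (line y t) ->
  is_derive t 1 (fun s => phi (line y s)) (partial ord0 phi (line y t)).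
Proof.
move=> dphi.
have E : (fun h : R =>
      h^-1 *: (phi (h *: delta_mx ord0 ord0 + line y t) - phi (line y t))) =
    (fun h : R => h^-1 *: (phi (line y (h *: 1 + t)) - phi (line y t))).
  by apply/funext => h; rewrite lineD.
apply: DeriveDef.
  have := @diff_derivable _ _ _ _ _ (delta_mx ord0 ord0) dphi.
  by rewrite /derivable E.
by rewrite /partial /derive E.
Qed.

(** The sum of [phi] and [x_1 d_1 phi] is the derivative of [x_1 phi] along the
    first axis, so its integral over each line parallel to that axis is zero, and
    so is its integral over the whole space. The compact set [K] stands for the
    support of [phi]. *)
Lemma integral_axis_parts phi (K : set 'rV[R]_N) : Ck 1 setT phi ->
  compact K -> (forall x, ~ K x -> phi x = 0) ->
  (forall x, ~ K x -> partial ord0 phi x = 0) ->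
  (\int[lebesgue_rV N]_x (- x ord0 ord0 * partial ord0 phi x)%:E =
   \int[lebesgue_rV N]_x (phi x)%:E)%E.
Proof.
move=> [dphi /(_ ord0) /= cdphi] cK phiK dphiK.
have cphi : continuous phi by move=> x; apply: differentiable_continuous; exact: dphi.
have {}cdphi : continuous (partial ord0 phi) by move=> x; exact: cdphi.
have cc : continuous (fun x : 'rV[R]_N => x ord0 ord0) by exact: coord_continuous.
pose v (x : 'rV[R]_N) := x ord0 ord0 * partial ord0 phi x.
have cv : continuous v by move=> x; exact: (cvgM (cc x) (cdphi x)).
have cw : continuous (fun x => phi x + v x) by move=> x; exact: (cvgD (cphi x) (cv x)).
have intphi := integrable_continuous_compact cphi cK phiK.
have intv : (lebesgue_rV N).-integrable setT (EFin \o v).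
  by apply: (integrable_continuous_compact cv cK) => x Kx; rewrite /v dphiK ?mulr0.
have intw : (lebesgue_rV N).-integrable setT (EFin \o (fun x => phi x + v x)).
  apply: (integrable_continuous_compact cw cK) => x Kx.
  by rewrite /v dphiK ?mulr0 ?phiK ?addr0.
have w0 : (\int[lebesgue_rV N]_x (phi x + v x)%:E = 0)%E.
  rewrite (integral_consrV intw); apply: integral0_eq => y _.
  have [M M0 KM] : exists2 M : R, 0 < M & K `<=` ball (0 : 'rV[R]_N) M.
    exact: bounded_sub_ball (compact_bounded cK).
  have out t : M <= `|t| -> ~ K (line y t).
    move=> Mt /KM /(ball_rVP _ _ M0) /(_ ord0); rewrite line0 mxE subr0.
    by rewrite ltNge Mt.
  pose W t := phi (line y t) + v (line y t).
  (* a primitive of W *)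
  pose G t := t * phi (line y t).
  have dG (t : R) : is_derive t 1 G (W t).
    have h := is_derive_line (dphi (line y t) I).
    rewrite /G; apply: is_derive_eq.
    by rewrite /W /v line0 addrC /GRing.scale /= mulr1.
  have cW : continuous W.
    move=> t; apply: (@continuous_comp _ _ _ (line y) (fun x => phi x + v x)).
      exact: continuous_line.
    exact: cw.
  have MM : - M < M by rewrite gtrN.
  transitivity (\int[lebesgue_measure]_(t in `[(- M)%R, M%R]) (W t)%:E)%E.
    rewrite [RHS]integral_mkcond; apply: eq_integral => t _.
    rewrite patchE; case: ifPn => // /negP; rewrite inE /= in_itv/= -ler_norml => /negP.
    rewrite -ltNge => /ltW/out nK.
    by rewrite /= /v phiK// dphiK// mulr0 addr0.
  have cG : continuous G.
    by move=> t; apply/differentiable_continuous/derivable1_diffP; have [] := dG t.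
  rewrite (@continuous_FTC2 _ W G)//.
  - rewrite /G (phiK (line y M)) ?(phiK (line y (- M))) ?mulr0 ?sube0//;
      by apply: out; rewrite ?normrN ger0_norm// ltW.
  - exact: continuous_subspaceT.
  - split.
    + by move=> t _; have [] := dG t.
    + by apply: cvg_at_right_filter; exact: cG.
    + by apply: cvg_at_left_filter; exact: cG.
  - by move=> t _; rewrite derive1E; exact: derive_val.
transitivity (\int[lebesgue_rV N]_x ((phi x)%:E - (phi x + v x)%:E))%E.
  by apply: eq_integral => x _; rewrite -EFinB opprD addNKr mulNr.
by rewrite (integralB_EFin measurableT intphi intw) w0 sube0.
Qed.

End WeakForm.

(** * The weak equation *)

Section Solution.
Context {R : realType} {n : nat}.
Local Notation N := n.+1.
Context (p c : R) (p12 : 1 < p < 2).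
Local Notation q := ((p - 1)^-1).

Lemma exponent_ge1 : 1 <= q.
Proof.
have /andP[p1 p2] := p12.
by rewrite invf_ge1 ?subr_gt0//; lra.
Qed.

(** The identity [q (p - 2) + q = 1] makes the flux linear. At [x_1 = 0] both
    sides vanish because the gradient does. *)
Lemma flux_profile (x y : 'rV[R]_N) :
  enorm (grad (profile q c) x) `^ (p - 2) * dotrV (grad (profile q c) x) y =
  - x ord0 ord0 * y ord0 ord0.
Proof.
have q1 := exponent_ge1; have q0 : 0 < q by apply: lt_le_trans q1.
have p0 : 0 < p - 1 by rewrite -invr_gt0.
rewrite dotr_grad_profile// enorm_grad_profile// mulrA mulrN; congr (- _ * _).
set t := x ord0 ord0; have [->|t0] := eqVneq t 0; first by rewrite spowR0 mulr0.
rewrite /spowR mulrCA -powRrM -powRD; last by rewrite normr_eq0 t0 implybT.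
have -> : q * (p - 2) + q = 1.
  by rewrite -{2}[q]mulr1 -mulrDr (_ : p - 2 + 1 = p - 1) ?mulVf ?gt_eqF//; ring.
by rewrite powRr1// -numEsg.
Qed.

Lemma test_function_vanish (Omega : set 'rV[R]_N) phi :
  test_function Omega phi ->
  forall x, ~ closure [set x | phi x != 0] x ->
    phi x = 0 /\ forall i, partial i phi x = 0.
Proof.
move=> [_ cK _] x Kx.
have near0 : \forall y \near x, phi y = 0.
  have oC : open (~` closure [set x | phi x != 0]).
    by apply: closed_openC; exact: closed_closure.
  have : nbhs x (~` closure [set x | phi x != 0]).
    by apply: open_nbhs_nbhs; split.
  apply: filterS => y Ky; apply/eqP/negP => /negP phiy; apply: Ky.
  exact: subset_closure.
split; first exact: nbhs_singleton near0.
move=> i; rewrite /partial (@near_eq_derive _ _ _ _ (cst 0)) ?derive_cst//.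
Qed.

(** A test function of [Omega] and its gradient vanish outside a compact subset
    of [Omega], so the equation on [Omega] is the equation on the whole space. *)
Lemma weak_profile (Omega : set 'rV[R]_N) :
  open Omega -> weak_pLaplace p Omega (profile q c) (fun=> 1).
Proof.
move=> oO phi tphi flux.
have fluxE : flux = fun x => - x ord0 ord0 * partial ord0 phi x.
  by apply/funext => x; rewrite /flux flux_profile mxE.
have [Cphi cK KO] := tphi.
set K := closure _ in cK KO.
have van := test_function_vanish tphi.
have phiK x : ~ K x -> phi x = 0 by move=> /van[].
have dphiK x : ~ K x -> partial ord0 phi x = 0 by move=> /van[].
have [dphi /(_ ord0) /= cd] := Cphi 1%N.
have cphi : continuous phi by move=> x; apply: differentiable_continuous; exact: dphi.
have {}cd : continuous (partial ord0 phi) by move=> x; exact: cd.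
have cflux : continuous flux.
  have cc : continuous (fun x : 'rV[R]_N => - x ord0 ord0).
    by apply: (@continuous_axis _ _ -%R); exact: opp_continuous.
  by rewrite fluxE => x; exact: (cvgM (cc x) (cd x)).
have fluxK x : ~ K x -> flux x = 0 by move=> Kx; rewrite fluxE dphiK ?mulr0.
have mO : measurable Omega by exact: measurable_open_rV.
have restr (f : 'rV[R]_N -> R) : (forall x, ~ K x -> f x = 0) ->
    (\int[lebesgue_rV N]_(x in Omega) (f x)%:E = \int[lebesgue_rV N]_x (f x)%:E)%E.
  move=> fK; rewrite integral_mkcond; apply: eq_integral => x _.
  rewrite patchE; case: ifPn => // /negP xO; rewrite fK// => /KO h.
  by apply: xO; rewrite inE.
have mul1E : (fun x => (1 * phi x)%:E) = EFin \o phi.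
  by apply/funext => x /=; rewrite mul1r.
split.
- apply: (@integrableS _ _ _ (lebesgue_rV N) setT) => //.
  exact: integrable_continuous_compact cflux cK fluxK.
- rewrite mul1E; apply: (@integrableS _ _ _ (lebesgue_rV N) setT) => //.
  exact: integrable_continuous_compact cphi cK phiK.
- rewrite (restr _ fluxK) mul1E (restr _ phiK) fluxE.
  exact: integral_axis_parts (Cphi 1%N) cK phiK dphiK.
Qed.

Lemma profile_gt0 (x : 'rV[R]_N) :
  `|x ord0 ord0| `^ (q + 1) < (q + 1) * c -> 0 < profile q c x.
Proof.
have q0 : 0 < q + 1 by rewrite addr_gt0// (lt_le_trans _ exponent_ge1).
by rewrite /profile subr_gt0 ltr_pdivrMr// mulrC.
Qed.

Lemma positive_weak_solution_profile (Omega : set 'rV[R]_N) : open Omega ->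
  (forall x, Omega x -> `|x ord0 ord0| `^ (q + 1) < (q + 1) * c) ->
  positive_weak_solution p Omega (fun=> 1) (profile q c).
Proof.
move=> oO hO; split; first by apply: Ck1_profile; exact: exponent_ge1.
  by move=> x /hO; exact: profile_gt0.
exact: weak_profile.
Qed.

End Solution.

Lemma condF_cst1 (R : realType) : condF (fun=> 1 : R).
Proof.
split => //; first by apply: continuous_subspaceT; exact: cst_continuous.
move=> s s0; exists setT; first exact: filterT.
by exists 0; split => // M M0 [x y] _ /=; rewrite subrr normr0 mulr_ge0// ltW.
Qed.

(** * Powers of the distance to a hyperplane *)

Section AxisWeight.
Context {R : realType} {n : nat}.
Local Notation N := n.+1.
Implicit Types (a r : R) (x z : 'rV[R]_N).

(** The weights [|Du|^(-sigma)] and [|Du|^(p-2)] of the solution are of this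
    form. *)
Definition axis_weight a (x : 'rV[R]_N) : \bar R := epow `|x ord0 ord0| (- a).

Local Open Scope ereal_scope.

Lemma axis_weight_ge0 a x : 0 <= axis_weight a x.
Proof. exact: epow_ge0. Qed.

Lemma measurable_axis_weight a D : measurable_fun D (axis_weight a).
Proof.
apply: measurable_funTS.
exact: (measurableT_comp (measurable_epow_norm (- a)) (measurable_coord ord0)).
Qed.

Lemma integral_axis_weight_le a : (0 <= a < 1)%R ->
  exists2 C : R, (0 < C)%R & forall D x r, measurable D -> (0 < r)%R ->
    \int[lebesgue_rV N]_(y in eball x r `&` D) axis_weight a y <=
    (C * r `^ (N%:R - a))%:E.
Proof.
move=> a01; have [C C0 hC] := integral_epow_ball a01.
exists (C * 2 ^+ n)%R => [|D x r mD r0]; first by rewrite mulr_gt0// exprn_gt0.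
have mE : measurable (eball x r `&` D).
  by apply: measurableI => //; exact: measurable_eball.
apply: (@le_trans _ _ (\int[lebesgue_rV N]_(y in ball x r) axis_weight a y)).
  apply: ge0_subset_integral => //.
  - exact: measurable_ball_rV.
  - exact: measurable_axis_weight.
  - by move=> y _; exact: axis_weight_ge0.
  - by move=> y [/eball_sub_ball].
rewrite /axis_weight (integral_ball_axis _ r0 (measurable_epow_norm (- a)))//; last first.
  by move=> t; exact: epow_ge0.
apply: (@le_trans _ _ ((C * r `^ (1 - a))%:E * ((r *+ 2) ^+ n)%:E)).
  by apply: lee_wpmul2r; [rewrite lee_fin exprn_ge0// mulrn_wge0// ltW|exact: hC].
rewrite -EFinM lee_fin.
have -> : (N%:R - a = n%:R + (1 - a) :> R)%R by rewrite -natr1 addrA.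
rewrite (@powRD _ r n%:R); last by rewrite (gt_eqF r0) implybT.
rewrite powR_mulrn ?(ltW r0)// -(mulr_natl r) exprMn le_eqVlt.
by apply/orP; left; apply/eqP; ring.
Qed.

Lemma integral_axis_weight_ge a : (0 <= a)%R ->
  exists2 C : R, (0 < C)%R & forall x r, x ord0 ord0 = 0%R -> (0 < r)%R ->
    (C * r `^ (N%:R - a))%:E <= \int[lebesgue_rV N]_(y in eball x r) axis_weight a y.
Proof.
move=> a0; exists ((2 / N.+1%:R) ^+ N)%R => [|x r x0 r0].
  by rewrite exprn_gt0// divr_gt0.
have mB s : measurable (ball x s) by exact: measurable_ball_rV.
have s0 : (0 < r / N.+1%:R)%R by rewrite divr_gt0.
apply: (@le_trans _ _ (\int[lebesgue_rV N]_(y in ball x (r / N.+1%:R)) (r `^ (- a))%:E)).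
  rewrite integral_cst// [X in _ * X]lebesgue_rV_ball// -EFinM lee_fin.
  rewrite powRD; last by rewrite (gt_eqF r0) implybT.
  rewrite powR_mulrn ?(ltW r0)// -(mulr_natl (r / _)) !exprMn le_eqVlt.
  by apply/orP; left; apply/eqP; ring.
apply: (@le_trans _ _ (\int[lebesgue_rV N]_(y in ball x (r / N.+1%:R)) axis_weight a y)).
  apply: ge0_le_integral => //.
  - by move=> y _; rewrite lee_fin powR_ge0.
  - exact: measurable_axis_weight.
  - move=> y /(ball_sub_eball r0) /eball_sub_ball /(ball_rVP _ _ r0) /(_ ord0).
    by rewrite x0 subr0 => /ltW yr; exact: lee_epowN.
apply: ge0_subset_integral => //.
- exact: measurable_eball.
- exact: measurable_axis_weight.
- by move=> y _; exact: axis_weight_ge0.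
- exact: ball_sub_eball.
Qed.

(** A cube around [z] inside [U] suffices: its first side is centred at the
    origin. *)
Lemma integral_axis_weight_pinfty a (U : set 'rV[R]_N) z : (1 <= a)%R ->
  open U -> U z -> z ord0 ord0 = 0%R ->
  \int[lebesgue_rV N]_(y in U) axis_weight a y = +oo.
Proof.
move=> a1 oU Uz z0.
have /nbhs_ballP[e /= e0 eU] : nbhs z U by apply: open_nbhs_nbhs; split.
apply/eqP; rewrite -leye_eq.
apply: (@le_trans _ _ (\int[lebesgue_rV N]_(y in ball z e) axis_weight a y)); last first.
  apply: ge0_subset_integral => //.
  - exact: measurable_ball_rV.
  - exact: measurable_open_rV.
  - exact: measurable_axis_weight.
  - by move=> y _; exact: axis_weight_ge0.
rewrite /axis_weight (integral_ball_axis _ e0 (measurable_epow_norm (- a))); last first.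
  by move=> t; exact: epow_ge0.
rewrite z0 integral_epow_pinfty// gt0_mulye// lte_fin exprn_gt0// mulr2n addr_gt0//.
Qed.

(** For [a < 0] the weight is a positive power of [|x_1|], bounded on the
    ball. *)
Lemma integral_axis_weight_lty a x r : (a < 1)%R -> (0 < r)%R ->
  \int[lebesgue_rV N]_(y in eball x r) axis_weight a y < +oo.
Proof.
move=> a1 r0; have [a0|a0] := leP 0%R a.
  have a01 : (0 <= a < 1)%R by rewrite a0.
  have [C _ /(_ setT x r measurableT r0)] := integral_axis_weight_le a01.
  by rewrite setIT => /le_lt_trans; apply; rewrite ltry.
have mE : measurable (eball x r) by exact: measurable_eball.
pose M := (`|x ord0 ord0| + r)%R.
apply: (@le_lt_trans _ _ (\int[lebesgue_rV N]_(y in ball x r) (M `^ (- a))%:E)).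
  apply: (@le_trans _ _ (\int[lebesgue_rV N]_(y in eball x r) (M `^ (- a))%:E)).
    apply: ge0_le_integral => //.
    - by move=> y _; exact: axis_weight_ge0.
    - exact: measurable_axis_weight.
    - move=> y /eball_sub_ball /(ball_rVP _ _ r0) /(_ ord0) xy.
      rewrite /axis_weight /epow oppr_lt0 ltNge (ltW a0) andbF lee_fin.
      rewrite ge0_ler_powR ?nnegrE ?oppr_ge0 ?(ltW a0)//; first by rewrite addr_ge0// ltW.
      rewrite -(subrK (x ord0 ord0) (y ord0 ord0)) (le_trans (ler_normD _ _))//.
      by rewrite addrC lerD2l ltW.
  apply: ge0_subset_integral => //.
  - exact: measurable_ball_rV.
  - by move=> y _; rewrite lee_fin powR_ge0.
  - exact: eball_sub_ball.
rewrite integral_cst; last exact: measurable_ball_rV.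
by rewrite [X in _ * X]lebesgue_rV_ball// -EFinM ltry.
Qed.

End AxisWeight.

Section Localize.
Context {R : realType} {n : nat}.

Lemma closure_ball_rV (z : 'rV[R]_n) (e : R) : closure (ball z (e / 2)) `<=` ball z e.
Proof.
move=> y /= cy; have [e0|e0] := ltP 0 e.
  have e20 : 0 < e / 2 by rewrite divr_gt0.
  have [w [zw yw]] := cy _ (nbhsx_ballx y _ e20).
  by rewrite (splitr e); apply: ball_triangle zw _; exact: ball_sym.
have [w [[]]] := cy setT filterT; by rewrite ltNge pmulr_lle0// e0.
Qed.

Lemma open_small_ball (U : set 'rV[R]_n) z : open U -> U z ->
  exists2 d : R, 0 < d & compactly_contained (ball z d) U.
Proof.
move=> oU Uz.
have /nbhs_ballP[e /= e0 eU] : nbhs z U by apply: open_nbhs_nbhs; split.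
exists (e / 2); first by rewrite divr_gt0.
split; last by apply: subset_trans eU; exact: closure_ball_rV.
apply: bounded_closed_compact; last exact: closed_closure.
exists (`|z| + e); split; first exact: num_real.
move=> M zM y /closure_ball_rV; rewrite mx_norm_ball /ball_ /= => zy.
rewrite (le_trans _ (ltW zM))// -(subrKC z y) (le_trans (ler_normD _ _))//.
by rewrite lerD2l distrC ltW.
Qed.

End Localize.

(** * Failure of the summability estimate *)

Section Optimality.
Context {R : realType} {n : nat}.
Local Notation N := n.+1.
Local Open Scope ereal_scope.

(** The kernel is monotone in [|x|], increasing or decreasing according to the
    sign of [gamma], so that its minimum on a shell is attained on the
    boundary. *)
Lemma epow_enorm_ge (gamma d e : R) : (0 < d)%R -> (d <= e)%R ->
  exists2 m : R, (0 < m)%R & forall x : 'rV[R]_N,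
    (d <= enorm x <= e)%R -> m%:E <= epow (enorm x) (- gamma).
Proof.
move=> d0 de; have e0 : (0 < e)%R by apply: lt_le_trans de.
exists (Num.min (d `^ (- gamma)) (e `^ (- gamma)))%R.
  by rewrite lt_min !powR_gt0.
move=> x /andP[dx xe]; have x0 : (0 < enorm x)%R by apply: lt_le_trans dx.
rewrite epow_gt0E// lee_fin ge_min.
have [g0|g0] := leP 0%R gamma.
  by rewrite (ler_powRN g0 x0 xe) orbT.
by rewrite ge0_ler_powR ?nnegrE ?oppr_ge0// ltW.
Qed.

(** On a small ball around the critical point [z] the kernel is evaluated from a
    point [x] of the ball that is shifted off [z] along the first axis. On the
    concentric ball of half the shift the distance to [x] is bounded from below
    and from above, while [|x_1|^(-t)] is not integrable there. *)
Lemma not_estimate_S (p c t gamma : R) (U : set 'rV[R]_N) z :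
  (1 < p < 2)%R -> (1 <= t)%R -> open U -> U z -> z ord0 ord0 = 0%R ->
  ~ estimate_S p U (profile (p - 1)^-1 c) t gamma.
Proof.
move=> p12 t1 oU Uz z0 S.
have q1 := exponent_ge1 p12; have q0 : (0 < (p - 1)^-1)%R by apply: lt_le_trans q1.
have p0 : (0 < p - 1)%R by rewrite -invr_gt0.
have [d d0 dU] := open_small_ball oU Uz.
have mB s : measurable (ball z s) by exact: measurable_ball_rV.
have [C hC] := S (ball z d) (ball_open z d) dU.
pose x := (z + (d / 2) *: delta_mx ord0 ord0)%R.
have d20 : (0 < d / 2)%R by rewrite divr_gt0.
have d40 : (0 < d / 4)%R by rewrite divr_gt0.
have dB : ball z (d / 4) `<=` ball z d.
  by apply: le_ball; rewrite ler_piMr ?(ltW d0)// invf_le1 ?ler1n.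
have xd : ball z d x.
  apply/(ball_rVP _ _ d0) => i.
  rewrite /x !mxE [X in (`|X - _|)%R]addrC addrK eqxx/= normrM (gtr0_norm d20).
  apply: (@le_lt_trans _ _ (d / 2)%R); last by rewrite gtr_pMr// invf_lt1// ltr1n.
  by rewrite ler_piMr ?(ltW d20)//; case: eqP => _; rewrite ?normr1 ?normr0.
have de : (d / 4 <= N%:R * d)%R.
  apply: (@le_trans _ _ d); first by rewrite ler_piMr ?(ltW d0)// invf_le1 ?ler1n.
  by rewrite ler_peMl ?(ltW d0)// ler1n.
have [m m0 hm] := epow_enorm_ge gamma d40 de.
have far y : ball z (d / 4)%R y -> (d / 4 <= enorm (x - y) <= N%:R * d)%R.
  move=> /(ball_rVP _ _ d40) zy; apply/andP; split.
    apply: le_trans (coord_le_enorm _ ord0); rewrite /x !mxE eqxx/= mulr1.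
    have := zy ord0; set s := y _ _; set r := z _ _ => /ltW.
    rewrite ler_norml => /andP[h1 h2].
    apply: le_trans (ler_norm _); lra.
  apply: enorm_le => [|i]; first exact: ltW.
  have := zy i; rewrite /x !mxE; set s := y _ _; set r := z _ _.
  set k := (d / 2 * _)%R => h.
  have k2 : (`|k| <= d / 2)%R.
    rewrite /k normrM (gtr0_norm d20) ler_piMr ?(ltW d20)//.
    by case: (_ && _); rewrite ?normr1 ?normr0.
  move: h k2; rewrite !ler_norml ltr_norml => /andP[h1 h2] /andP[h3 h4].
  by apply/andP; split; lra.
pose F y := epow (enorm (grad (profile (p - 1)^-1 c) y)) (- ((p - 1) * t)) *
            epow (enorm (x - y)) (- gamma).
have FE : F = fun y => axis_weight t y * epow (enorm (x - y)) (- gamma).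
  apply/funext => y; rewrite /F enorm_grad_profile// epow_powR//.
  by rewrite mulrN mulrA mulVf ?gt_eqF// mul1r.
have F0 y : 0 <= F y by rewrite mule_ge0 ?epow_ge0.
have mF : measurable_fun setT F.
  rewrite FE; apply: emeasurable_funM; first exact: measurable_axis_weight.
  rewrite (_ : (fun _ => _) = (fun s => epow `|s| (- gamma)) \o (fun y => enorm (x - y))).
    apply: (measurableT_comp (measurable_epow_norm (- gamma))).
    apply: continuous_measurable_rV => y.
    apply: continuous_comp; last exact: continuous_enorm.
    apply: (@continuousB _ _ _ (cst x) id); first exact: cst_continuous.
    exact: (fun _ => id).
  by apply/funext => y /=; rewrite ger0_norm// sqrtr_ge0.
have := hC x xd; rewrite leNgt => /negP; apply.
apply: (@lt_le_trans _ _ (\int[lebesgue_rV N]_(y in ball z (d / 4)%R) F y)); last first.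
  apply: ge0_subset_integral => //; exact: measurable_funTS.
apply: (@lt_le_trans _ _
  (\int[lebesgue_rV N]_(y in ball z (d / 4)%R) (axis_weight t y * m%:E))).
  rewrite ge0_integralZr//; last 3 first.
  - exact: measurable_axis_weight.
  - by move=> y _; exact: axis_weight_ge0.
  - by rewrite lee_fin ltW.
  rewrite (@integral_axis_weight_pinfty _ _ t _ z)//.
  - by rewrite gt0_mulye ?lte_fin// ltry.
  - exact: ball_open.
  - exact: ballxx.
apply: ge0_le_integral => //.
- by move=> y _; rewrite mule_ge0 ?axis_weight_ge0// lee_fin ltW.
- by apply: emeasurable_funM => //; exact: measurable_axis_weight.
- exact: measurable_funTS.
- move=> y /far yf; rewrite FE; apply: lee_wpmul2l; first exact: axis_weight_ge0.
  exact: hm.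
Qed.

End Optimality.

(** * The proposition *)

Theorem proposition9 (R : realType) (n : nat) (p c : R) :
  1 < p < 2 -> 0 < c ->
  let N := n.+2 in
  let p' := p / (p - 1) in
  let u := fun x : 'rV[R]_N => c - `|x ord0 ord0| `^ p' / p' in
  let Z := critical_set u in
  let rho := fun x : 'rV[R]_N => epow (enorm (grad u x)) (p - 2) in
  let theta := (2 - p) / (p - 1) in
  let good_ball := fun (x0 : 'rV[R]_N) (r : R) =>
    0 < r /\ (forall x, eball x0 r x -> `|x ord0 ord0| `^ p' < p' * c) in
  [/\ Ck 1 setT u,
      weak_pLaplace p setT u (fun=> 1),
      condF (fun=> 1 : R),
      forall x0 r, good_ball x0 r ->
        positive_weak_solution p (eball x0 r) (fun=> 1) u &
      (forall x, enorm (grad u x) = `|x ord0 ord0| `^ (p - 1)^-1) /\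
      Z = [set x : 'rV[R]_N | x ord0 ord0 = 0]]
  /\
  (* (i) *)
  ((forall x0 r, good_ball x0 r -> eball x0 r `&` Z !=set0 ->
      (forall sigma : R,
         (\int[lebesgue_rV N]_(x in eball x0 r)
             epow (enorm (grad u x)) (- sigma) < +oo)%E <-> sigma < p - 1) /\
      (forall t gamma : R, 1 <= t -> admissible_gamma N gamma ->
         ~ estimate_S p (eball x0 r) u t gamma)) /\
   (forall t gamma : R, 1 <= t -> admissible_gamma N gamma ->
      ~ general_estimate_S N p t gamma))
  /\
  (* (ii) *)
  (forall x0 r, good_ball x0 r -> eball x0 r `&` Z !=set0 ->
     ((lebesgue_rV N).-integrable (eball x0 r) rho <-> 3 / 2 < p) /\
     (p <= 3 / 2 ->
        ~ locally_integrable_rV (eball x0 r) rho /\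
        forall Omega' : set 'rV[R]_N,
          open Omega' -> Omega' `<=` eball x0 r -> Omega' `&` Z !=set0 ->
          ~ exists V, is_H12 Omega' rho V))
  /\
  (* (iii) *)
  ((3 / 2 < p ->
     [/\ 0 < theta < 1,
         exists a b : R, [/\ 0 < a, 0 < b &
           forall x0 (r : R), Z x0 -> 0 < r ->
             ((a * r `^ (N%:R - theta))%:E <=
                \int[lebesgue_rV N]_(x in eball x0 r) rho x <=
              (b * r `^ (N%:R - theta))%:E)%E],
         1 < 2 - theta &
         forall Omega' : set 'rV[R]_N, domain Omega' -> bounded_set Omega' ->
           exists lambda0 Lambda0 : R,
             [/\ 0 < lambda0, 0 < Lambda0 &
                 condM lambda0 Lambda0 (2 - theta) Omega' rho]]) /\
   (p <= 3 / 2 -> forall x0 (r : R), Z x0 -> 0 < r ->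
      (\int[lebesgue_rV N]_(x in eball x0 r) rho x)%E = +oo%E)).
Proof.
move=> p12 c0 N p' u Z rho theta good_ball.
have /andP[p1 p2] := p12.
have p10 : 0 < p - 1 by rewrite subr_gt0.
have q1 := exponent_ge1 p12; have q0 : 0 < (p - 1)^-1 by rewrite invr_gt0.
have p'E : p' = (p - 1)^-1 + 1.
  by rewrite /p'; field; rewrite gt_eqF.
have uE : u = profile (p - 1)^-1 c by rewrite /u p'E.
have ZE : Z = [set x | x ord0 ord0 = 0] by rewrite /Z uE critical_set_profile.
have weightE s : (fun x : 'rV[R]_N => epow (enorm (grad u x)) s) =
    axis_weight (- s / (p - 1)).
  apply/funext => x; rewrite uE enorm_grad_profile// epow_powR//.
  by rewrite /axis_weight mulNr opprK mulrC.
have thetaE : theta = - (p - 2) / (p - 1) by rewrite opprB.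
have rhoE : rho = axis_weight theta by rewrite thetaE -weightE.
have theta0 : 0 < theta by rewrite divr_gt0// subr_gt0.
have theta_lt1 : (theta < 1) = (3 / 2 < p).
  by rewrite /theta ltr_pdivrMr// mul1r; apply/idP/idP => h; lra.
have theta_ge1 : p <= 3 / 2 -> 1 <= theta by rewrite leNgt -theta_lt1 -leNgt.
have sol x0 r : good_ball x0 r -> positive_weak_solution p (eball x0 r) (fun=> 1) u.
  move=> [_ hx]; rewrite uE; apply: positive_weak_solution_profile => //.
    exact: open_eball.
  by move=> x /hx; rewrite p'E.
have infinite (U : set 'rV[R]_N) z : p <= 3 / 2 -> open U -> U z -> Z z ->
    (\int[lebesgue_rV N]_(x in U) rho x = +oo)%E.
  move=> /theta_ge1 t1 oU Uz; rewrite ZE rhoE => z0.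
  exact: integral_axis_weight_pinfty t1 oU Uz z0.
(* U is the open set on which the weight is already not integrable; D is a
   compact set in one of the applications. *)
have not_integrable (U D : set 'rV[R]_N) z : p <= 3 / 2 -> measurable D -> open U ->
    U `<=` D -> U z -> Z z -> ~ (lebesgue_rV N).-integrable D rho.
  move=> p32 mD oU UD Uz Zz /integrableS => /(_ U mD (measurable_open_rV oU) UD).
  move=> /integrableP[_]; rewrite rhoE.
  under eq_integral do rewrite gee0_abs ?axis_weight_ge0//.
  by rewrite -rhoE (infinite _ _ p32 oU Uz Zz) ltxx.
split; last split; last split.
- split.
  + by rewrite uE; exact: Ck1_profile.
  + by rewrite uE; apply: weak_profile => //; exact: openT.
  + exact: condF_cst1.
  + exact: sol.
  + by split => // x; rewrite uE enorm_grad_profile.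
- split.
  + move=> x0 r [r0 _] [z [Bz]]; rewrite ZE => z0; split.
      move=> sigma; rewrite weightE opprK; split => [|sp].
        apply: contraPT; rewrite -leNgt => sp.
        rewrite (@integral_axis_weight_pinfty _ _ _ _ z)// ?ltxx//.
          by rewrite ler_pdivlMr// mul1r.
        exact: open_eball.
      by apply: integral_axis_weight_lty => //; rewrite ltr_pdivrMr// mul1r.
    by move=> t gamma t1 _; rewrite uE; apply: not_estimate_S z0 => //; exact: open_eball.
  + move=> t gamma t1 _ S.
    (* c = 1 on the unit ball, where |x_1|^(q+1) < 1 < q + 1 *)
    apply: (@not_estimate_S R n.+1 p 1 t gamma (eball 0 1) 0 p12 t1) => //.
    - exact: open_eball.
    - exact: eball_center.
    - by rewrite mxE.
    apply: (S _ (fun=> 1)); [exact: domain_eball|exact: condF_cst1|].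
    apply: positive_weak_solution_profile => //; first exact: open_eball.
    move=> x /eball_sub_ball /(ball_rVP _ _ ltr01) /(_ ord0).
    rewrite mxE subr0 mulr1 => x1.
    apply: (@le_lt_trans _ _ 1); last by rewrite ltrDr.
    have [->|xn0] := eqVneq (x ord0 ord0) 0.
      by rewrite normr0 powR0// gt_eqF// addr_gt0.
    apply: le_trans (ltW x1); rewrite ge1r_powR ?normr_gt0 ?xn0 ?(ltW x1)//.
    by rewrite lerDr ltW.
- move=> x0 r [r0 _] [z [Bz Zz]].
  have mB : measurable (eball x0 r) by exact: measurable_eball.
  split.
    split => [intr|p32].
      rewrite ltNge; apply/negP => p32.
      apply: (not_integrable (eball x0 r) (eball x0 r) z) intr => //.
      exact: open_eball.
    apply/integrableP; rewrite rhoE; split; first exact: measurable_axis_weight.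
    under eq_integral do rewrite gee0_abs ?axis_weight_ge0//.
    by apply: integral_axis_weight_lty => //; rewrite theta_lt1.
  move=> p32; split.
    move=> locint; have [d d0 [cK KB]] := open_small_ball (@open_eball _ _ x0 r) Bz.
    have := locint _ cK KB.
    apply: (not_integrable (ball z d) _ z) => //.
    + rewrite -[X in measurable X]setCK; apply: measurableC; apply: measurable_open_rV.
      by apply: closed_openC; exact: closed_closure.
    + exact: ball_open.
    + exact: subset_closure.
    + exact: ballxx.
  move=> Omega' oO OB [y [Oy Zy]] [V [_ intr _]].
  by apply: (not_integrable Omega' Omega' y) intr => //; exact: measurable_open_rV.
split => [p32|p32 x0 r Zx0 r0]; last first.
  by apply: (infinite _ x0) => //; [exact: open_eball|exact: eball_center].
have theta01 : 0 < theta < 1 by rewrite theta0 theta_lt1.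
have theta01' : 0 <= theta < 1 by rewrite (ltW theta0) theta_lt1.
have [C C0 hC] := @integral_axis_weight_le R n.+1 theta theta01'.
have [b b0 hb] := @integral_axis_weight_ge R n.+1 theta (ltW theta0).
split => //.
- exists b, C; split => // x0 r; rewrite ZE => x00 r0; rewrite rhoE hb//=.
  by have := hC setT x0 r measurableT r0; rewrite setIT.
- by rewrite ltrBrDr -ltrBrDl; lra.
move=> Omega' dO bO; have [oO _ _] := dO.
have [M M0 OM] := bounded_sub_ball bO.
exists (M `^ (- theta)), C; split => //; first exact: powR_gt0.
split.
- by rewrite rhoE; exact: measurable_axis_weight.
- move=> x _; rewrite rhoE /axis_weight /epow; case: ifPn => [_|].
    exact: ltry.
  rewrite normr_eq0 oppr_lt0 theta0 andbT lte_fin => x0.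
  by rewrite powR_gt0 ?normr_gt0.
- apply: aeW => x /OM /(ball_rVP _ _ M0) /(_ ord0); rewrite mxE subr0 rhoE => xM.
  by apply: lee_epowN => //; exact: ltW.
- move=> x r r0; rewrite rhoE.
  have -> : N%:R - 2 + (2 - theta) = N%:R - theta by rewrite addrA subrK.
  apply: hC => //; exact: measurable_open_rV.
Qed.
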